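(* Let $(R,\mathfrak m,k)$ be a local ring. Suppose that for some inflation $R\to(R',\mathfrak m',k')$ the ideal $\mathfrak m'$ has a Conca generator. Set $e=\operatorname{rank}_k(\mathfrak m/\mathfrak m^2)$ and $r=\operatorname{rank}_k(\mathfrak m^2/\mathfrak m^3)$. Then $R$ is Koszul, each finite $R$-module $M$ has a Koszul syzygy module (that is, $\Omega^R_n(M)$ is Koszul for some $n\ge0$), and one has $$P^R_k(t)=\frac{1}{1-et+rt^2},$$ and, for each finite $R$-module $M$, $$P^R_M(t)=\frac{p_M(t)}{1-et+rt^2}\quad\text{with}\quad p_M(t)\in\mathbb Z[t].$$
   Context: A local ring $(R,\mathfrak m,k)$ is a commutative Noetherian ring $R$ with unique maximal ideal $\mathfrak m$ and residue field $k=R/\mathfrak m$. ''Finite module'' means finitely generated module; $\operatorname{rank}_k$ is dimension over $k$. Inflation: a ring homomorphism $R\to R'$ to a local ring $(R',\mathfrak m',k')$ making $R'$ a flat $R$-module with $\mathfrak m'=R'\mathfrak m$. Conca generator: an element $x$ is a Conca generator of an ideal $J$ if $x\in J$, $x\neq0=x^2$ and $xJ=J^2$. Syzygies: $\Omega^R_n(M)=\operatorname{Coker}(\partial^F_{n+1})$, where $F$ is a minimal free resolution of $M$ (so $\Omega^R_0(M)\cong M$). Poincaré series: $P^R_M(t)=\sum_{n\ge0}\operatorname{rank}_k\operatorname{Ext}^n_R(M,k)\,t^n\in\mathbb Z[[t]]$. Koszul: Let $F$ be a minimal free resolution of a finite $R$-module $M$, so $\partial(F)\subseteq\mathfrak mF$.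 For each $j\ge0$ the differential and the augmentation $F_0\to M$ induce a complex of $k$-vector spaces $$\operatorname{lin}_j(F)=\quad 0\to \frac{F_j}{\mathfrak mF_j}\to\cdots\to\frac{\mathfrak m^{j-n}F_n}{\mathfrak m^{j+1-n}F_n}\to\cdots\to\frac{\mathfrak m^{j}F_0}{\mathfrak m^{j+1}F_0}\to\frac{\mathfrak m^jM}{\mathfrak m^{j+1}M}\to0.$$ $M$ is Koszul if $\operatorname{lin}_j(F)$ is acyclic (exact) for every $j\ge0$. The ring $R$ is Koszul if $k$ is a Koszul $R$-module. *)

(* Defs.v *)
From HB Require Import structures.
From mathcomp Require Import all_boot all_order all_algebra generic_quotient.
From mathcomp Require Import ring_quotient.
From mathcomp Require Import boolp classical_sets functions.

Set Implicit Arguments.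
Unset Strict Implicit.
Unset Printing Implicit Defensive.

Import GRing.Theory.
Local Open Scope classical_set_scope.
Local Open Scope ring_scope.

Definition is_submodule (R : comNzRingType) (V : lmodType R) (W : set V) : Prop :=
  W 0 /\ forall a x y, W x -> W y -> W (a *: x + y).

Record submodule (R : comNzRingType) (V : lmodType R) := Submodule {
  submodule_set :> set V;
  submoduleP : is_submodule submodule_set }.

Notation ideal R := (@submodule R (GRing.regular R)).

Section Span.
Variables (R : comNzRingType) (V : lmodType R).
Implicit Types S : set V.

Lemma span_subproof S :
  is_submodule [set x | forall W, is_submodule W -> S `<=` W -> W x].
Proof.
split=> [W [] //|a x y hx hy W Wsub SW].
by apply: Wsub.2; [exact: hx|exact: hy].
Qed.

Definition span S : submodule V := Submodule (span_subproof S).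

End Span.

Lemma range_subproof (R : comNzRingType) (U V : lmodType R)
  (f : {linear U -> V}) : is_submodule (range f).
Proof.
split; first by exists 0; rewrite ?linear0.
by move=> a _ _ [x _ <-] [y _ <-]; exists (a *: x + y); rewrite ?linearP.
Qed.

Definition range_submodule (R : comNzRingType) (U V : lmodType R)
  (f : {linear U -> V}) : submodule V := Submodule (range_subproof f).

Section QuotientModule.
Local Open Scope quotient_scope.
Variables (R : comNzRingType) (V : lmodType R) (W : submodule V).

Definition submodule_pred : V -> bool := fun x => `[< submodule_set W x >].

Lemma submodule_pred_closed : zmod_closed submodule_pred.
Proof.
have [W0 WP] := submoduleP W; split; first exact/asboolP.
move=> x y /asboolP Wx /asboolP Wy; apply/asboolP.
by rewrite addrC -scaleN1r; apply: WP.
Qed.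

HB.instance Definition _ :=
  GRing.isZmodClosed.Build V submodule_pred submodule_pred_closed.

Local Notation quotW := (Quotient.quot (GRing.ZmodClosed.clone V submodule_pred _)).

Definition quotient_module : Type := quotW.
HB.instance Definition _ := GRing.Zmodule.on quotient_module.

Definition quotient_proj (x : V) : quotient_module :=
  \pi_quotW x.

Definition quotient_scale (a : R) (q : quotient_module) : quotient_module :=
  quotient_proj (a *: repr (q : quotW)).

Lemma quotient_projE x y : quotient_proj x = quotient_proj y <-> submodule_set W (x - y).
Proof.
split=> [/eqP|Wxy]; first by rewrite -Quotient.idealrBE => /asboolP.
by apply/eqP; rewrite -Quotient.idealrBE; apply/asboolP.
Qed.

Lemma quotient_projD x y :
  quotient_proj (x + y) = quotient_proj x + quotient_proj y.
Proof. by rewrite /quotient_proj raddfD. Qed.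

Lemma quotient_proj_surj q : exists x, quotient_proj x = q.
Proof.
exists (repr (q : quotW)); exact: reprK.
Qed.

Lemma quotient_projZ a x :
  quotient_proj (a *: x) = quotient_scale a (quotient_proj x).
Proof.
apply/quotient_projE; rewrite -scalerBr -[_ *: _]addr0.
have [W0 WP] := submoduleP W; apply: WP => //.
by apply/quotient_projE; rewrite {2}/quotient_proj reprK.
Qed.

Lemma quotient_scaleA a b q :
  quotient_scale a (quotient_scale b q) = quotient_scale (a * b) q.
Proof.
by have [x <-] := quotient_proj_surj q; rewrite -!quotient_projZ scalerA.
Qed.

Lemma quotient_scale1 : left_id 1 quotient_scale.
Proof.
by move=> q; have [x <-] := quotient_proj_surj q; rewrite -quotient_projZ scale1r.
Qed.

Lemma quotient_scaleDr : right_distributive quotient_scale +%R.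
Proof.
move=> a p q; have [x <-] := quotient_proj_surj p.
have [y <-] := quotient_proj_surj q.
by rewrite -quotient_projD -!quotient_projZ scalerDr quotient_projD.
Qed.

Lemma quotient_scaleDl q : {morph quotient_scale^~ q : a b / a + b}.
Proof.
move=> a b; have [x <-] := quotient_proj_surj q.
by rewrite -!quotient_projZ scalerDl quotient_projD.
Qed.

HB.instance Definition _ := GRing.Zmodule_isLmodule.Build R quotient_module
  quotient_scaleA quotient_scale1 quotient_scaleDr quotient_scaleDl.

End QuotientModule.

Section IdealsAndModules.
Variable R : comNzRingType.

Definition ideal_smul (V : lmodType R) (I : set R^o) (A : set V) : submodule V :=
  span [set (a : R) *: x | a in I & x in A].

Fixpoint ideal_pow (I : set R^o) (n : nat) : set R^o :=
  if n is n'.+1 then ideal_smul I (ideal_pow I n') else [set: R^o].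

Definition finitely_generated (V : lmodType R) (A : set V) : Prop :=
  exists s : seq V, A = span [set x | x \in s].

Definition finite_module (V : lmodType R) : Prop :=
  finitely_generated [set: V].

Definition noetherian_ring : Prop := forall I : ideal R, finitely_generated I.

Definition maximal_ideal (I : ideal R) : Prop :=
  (I : set R^o) <> [set: R^o] /\
  forall J : ideal R, I `<=` J -> J = I :> set R^o \/ J = [set: R^o] :> set R^o.

Definition local_ring (m : ideal R) : Prop :=
  [/\ noetherian_ring, maximal_ideal m
    & forall J : ideal R, maximal_ideal J -> J = m :> set R^o].

Definition conca_generator (J : set R^o) (x : R) : Prop :=
  [/\ J x, x != 0, x ^+ 2 = 0 & [set x * y | y in J] = ideal_pow J 2].

(* By the universal property of the tensor product, the element
   \sum_i x_i (x) y_i of M (x)_R N vanishes iff every R-bilinear map on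
   M x N sends it to zero; s is the list of the pairs (x_i, y_i). *)
Definition tensor_eq0 (M N : lmodType R) (s : seq (M * N)) : Prop :=
  forall (P : lmodType R) (b : M -> N -> P),
    (forall y, linear (b ^~ y)) -> (forall x, linear (b x)) ->
    \sum_(p <- s) b p.1 p.2 = 0.

(* Every element of M (x) A is a sum of pure tensors, so this is the
   injectivity of M (x) f for every injective f. *)
Definition flat_module (M : lmodType R) : Prop :=
  forall (A B : lmodType R) (f : {linear A -> B}), injective f ->
  forall s : seq (M * A),
    tensor_eq0 [seq (p.1, f p.2) | p <- s] -> tensor_eq0 s.

End IdealsAndModules.

(* A ring homomorphism R -> R' of commutative rings is the same thing as a
   commutative R-algebra structure on R', with structure map a |-> a%:A. *)
Definition inflation (R : comNzRingType) (m : ideal R)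
    (R' : comAlgType R) (m' : ideal R') : Prop :=
  [/\ local_ring m', flat_module (R' : lmodType R)
    & m' = span [set ((a : R)%:A : R'^o) | a in m] :> set R'^o].

Section LocalRing.
Variables (R : comNzRingType) (m : ideal R).

Definition residue_field : lmodType R := quotient_module m.

(* For submodules B `<=` A of V with m A `<=` B, the quotient A / B is a vector
   space over k = R / m, and v represents a basis of it; the scalars in k are
   represented by elements of R, which vanish in k iff they lie in m. *)
Definition represents_basis (V : lmodType R) (A B : set V) (n : nat)
    (v : 'I_n -> V) : Prop :=
  [/\ forall i, A (v i),
      forall x, A x -> exists a : 'I_n -> R, B (x - \sum_i a i *: v i)
    & forall a : 'I_n -> R, B (\sum_i a i *: v i) -> forall i, submodule_set m (a i)].

Definition has_rank (V : lmodType R) (A B : set V) (n : nat) : Prop :=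
  exists v : 'I_n -> V, represents_basis A B v.

(* dim_k (A / B), and 0 when that dimension is infinite *)
Definition rank (V : lmodType R) (A B : set V) : nat := xget 0%N (has_rank A B).

(* Resolutions by free modules F_n = R^(frank n) of finite rank. The differential
   F_(n+1) -> F_n is right multiplication of row vectors by a matrix. *)
Record free_resolution (M : lmodType R) := FreeResolution {
  frank : nat -> nat;
  dmx : forall n, 'M[R]_(frank n.+1, frank n);
  augm : {linear 'rV[R]_(frank 0) -> M};
  augm_surj : range augm = [set: M];
  augm_exact : [set x | augm x = 0] =
    range (fun y : 'rV[R]_(frank 1) => y *m dmx 0);
  diff_exact : forall n,
    [set x : 'rV[R]_(frank n.+1) | x *m dmx n = 0] =
    range (fun y : 'rV[R]_(frank n.+2) => y *m dmx n.+1) }.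

Section Resolution.
Variables (M : lmodType R) (F : free_resolution M).

Definition chain n : lmodType R := 'rV[R]_(frank F n).

Definition bd n : {linear chain n.+1 -> chain n} := mulmxr (dmx F n).

Definition minimal_resolution : Prop :=
  forall n, range (bd n) `<=` ideal_smul m [set: chain n].

(* Coker (F_(n+1) -> F_n) *)
Definition syzygy n : lmodType R := quotient_module (range_submodule (bd n)).

Definition ext_cocycles (N : lmodType R) n : set (chain n -> N) :=
  [set f | linear f /\ forall x, f (bd n x) = 0].

Definition ext_coboundaries (N : lmodType R) n : set (chain n -> N) :=
  match n with
  | 0%N => [set 0]
  | n'.+1 => [set f | exists2 g : chain n' -> N, linear g & f = g \o bd n']
  end.

(* The n-th term of lin_j(F) is lin_num j n / lin_den j n; it is zero
   for n > j. *)
Definition lin_num j n : set (chain n) :=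
  if (n <= j)%N then submodule_set (ideal_smul (ideal_pow m (j - n)) [set: chain n])
  else [set 0].

Definition lin_den j n : set (chain n) :=
  if (n <= j)%N then submodule_set (ideal_smul (ideal_pow m (j.+1 - n)) [set: chain n])
  else [set 0].

Arguments lin_num : clear implicits.
Arguments lin_den : clear implicits.

Definition filt j : set M := ideal_smul (ideal_pow m j) [set: M].

(* Each clause says that a cycle, represented by an element of a numerator,
   is a boundary modulo the denominator: at M, at F_0, and at F_(n+1). *)
Definition lin_acyclic j : Prop :=
  [/\ forall y, filt j y ->
        exists2 z, lin_num j 0 z & filt j.+1 (y - augm F z),
      forall x, lin_num j 0 x -> filt j.+1 (augm F x) ->
        exists2 z, lin_num j 1 z & lin_den j 0 (x - bd 0 z)
    & forall n x, lin_num j n.+1 x -> lin_den j n (bd n x) ->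
        exists2 z, lin_num j n.+2 z & lin_den j n.+1 (x - bd n.+1 z)].

End Resolution.
Arguments ext_cocycles {M} F N n _.
Arguments ext_coboundaries {M} F N n _.
Arguments lin_num {M} F j n _.
Arguments lin_den {M} F j n _.

(* Minimal free resolutions are unique up to isomorphism, so it does not
   matter which one is used. *)
Definition koszul_module (M : lmodType R) : Prop :=
  exists2 F : free_resolution M,
    minimal_resolution F & forall j, lin_acyclic F j.

Definition koszul_ring : Prop := koszul_module residue_field.

(* rank_k Ext^n_R(M, k) = b, with Ext computed as the cohomology of
   Hom_R(F, k) for a free resolution F of M *)
Definition has_ext_rank (M : lmodType R) (n b : nat) : Prop :=
  exists F : free_resolution M,
    has_rank (ext_cocycles F residue_field n)
             (ext_coboundaries F residue_field n) b.

(* Elements of Z[[t]] are represented by their coefficient sequences. *)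
Definition poincare_series (M : lmodType R) : nat -> int :=
  fun n => (xget 0%N (has_ext_rank M n))%:Z.

End LocalRing.
Arguments ext_cocycles {R M} F N n _.
Arguments ext_coboundaries {R M} F N n _.
Arguments lin_num {R} m {M} F j n _.
Arguments lin_den {R} m {M} F j n _.

Definition pseries_mul (f g : nat -> int) : nat -> int :=
  fun n => \sum_(i < n.+1) f i * g (n - i)%N.

(* P = p / q in Z[[t]], for a polynomial q with q(0) invertible *)
Definition pseries_eq_frac (P : nat -> int) (p q : {poly int}) : Prop :=
  q`_0 \is a GRing.unit /\ pseries_mul P (fun n => q`_n) = (fun n => p`_n).

(* Main.v *)
(* Let x be a Conca generator of the maximal ideal m of R (after inflation), so
   x^2 = 0 and m^2 = xm, whence m^3 = 0. For N inside mF with minimal free cover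
   G -> N and syzygy module N' inside mG, multiplication by x induces an
   epimorphism from mN/xN = mG/(N' + xG) onto m^2G/xN', which contains mN'/xN'.
   Hence dim(mN'/xN') + dim(m^2G/mN') <= dim(mN/xN): along a minimal resolution F
   of M these dimensions decrease, so m^2 F_n = m Omega_(n+1) for all large n, and
   for all n if M = k, where they start at 0. This equality descends along the
   inflation. Since m^3 = 0 it makes the corresponding syzygies Koszul, and
   counting dimensions in m^2 F_n <= Omega_(n+1) <= m F_n turns it into the
   recurrence b_(n+2) = e b_(n+1) - r b_n for the Betti numbers. *)
From HB Require Import structures.
Require Import Defs.
From mathcomp Require Import all_boot all_order all_algebra.
From mathcomp Require Import ring_quotient ring.
From mathcomp Require Import boolp classical_sets functions.

Set Implicit Arguments.
Unset Strict Implicit.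
Unset Printing Implicit Defensive.

Import GRing.Theory.
Local Open Scope classical_set_scope.
Local Open Scope ring_scope.

(* vector.v has another notion of this name *)
Local Notation span := Defs.span.

(** * Submodules and local rings *)

(** No tensor product is ever formed. Base change is the entrywise image of a matrix under R -> R',
    and flatness serves as one statement about linear equations: every solution over R' of a
    homogeneous system with coefficients in R is an R'-combination of solutions over R. Since mR'
    lies in m' and 1 does not, an inhomogeneous system over R that is solvable over R' is then
    solvable over R. This is how the inclusion of m^2 F_n in m Omega_(n+1) comes down to R.

    Dimensions over k' and over k are never compared. Those over k' only bound the defect of this
    inclusion: the defect is at most the drop of a nonincreasing sequence of natural numbers, so it
    vanishes once the sequence is constant, and a zero defect is an inclusion, which descends. Those
    over k count Betti numbers and are computed over R alone.

    A dimension is the length of a family representing a basis of a subquotient, so its uniqueness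
    has to be proved; this is done with determinants over R/m.

    The Poincare series is defined through an arbitrary free resolution, which is why comparison of
    resolutions up to homotopy is needed before the Betti numbers of a minimal one can be used. *)

Section Submodules.
Variables (R : comNzRingType) (V : lmodType R).
Implicit Types (W S : set V) (I : set R^o).

Lemma submod0 W : is_submodule W -> W 0.
Proof. by case. Qed.

Lemma submodZ W : is_submodule W -> forall a x, W x -> W (a *: x).
Proof. by move=> [W0 WP] a x Wx; rewrite -[_ *: _]addr0; apply: WP. Qed.

Lemma submodD W : is_submodule W -> forall x y, W x -> W y -> W (x + y).
Proof. by move=> [W0 WP] x y Wx Wy; rewrite -[x]scale1r; apply: WP. Qed.

Lemma submodN W : is_submodule W -> forall x, W x -> W (- x).
Proof. by move=> Wsub x Wx; rewrite -scaleN1r; apply: submodZ. Qed.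

Lemma submodB W : is_submodule W -> forall x y, W x -> W y -> W (x - y).
Proof. by move=> Ws x y Wx Wy; apply: submodD => //; apply: submodN. Qed.

Lemma submod_subl W : is_submodule W -> forall x y, W (x - y) -> W y -> W x.
Proof. by move=> Ws x y Wxy Wy; rewrite -(subrK y x); apply: submodD. Qed.

Lemma submod_sum W : is_submodule W -> forall (J : finType) (v : J -> V),
  (forall j, W (v j)) -> W (\sum_j v j).
Proof.
move=> Ws J v Wv; elim/big_ind: _ => // *; first exact: submod0.
exact: submodD.
Qed.

Lemma submod_zero : is_submodule [set 0 : V].
Proof. by split=> // a x y -> ->; rewrite scaler0 addr0. Qed.

Lemma submod_setT : is_submodule [set: V].
Proof. by []. Qed.

Lemma subset_span S : S `<=` span S.
Proof. by move=> x Sx W _; apply. Qed.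

Lemma span_min S W : is_submodule W -> S `<=` W -> span S `<=` W.
Proof. by move=> Wsub SW x; apply. Qed.

Lemma ideal_smul_min I S W : is_submodule W ->
  (forall a x, I a -> S x -> W ((a : R) *: x)) -> ideal_smul I S `<=` W.
Proof. by move=> Ws IS; apply: span_min => // _ [a Ia [x Sx <-]]; apply: IS. Qed.

Lemma ideal_smulZ I S a x : I a -> S x ->
  submodule_set (ideal_smul I S) ((a : R) *: x).
Proof. by move=> Ia Sx; apply: subset_span; exists a => //; exists x. Qed.

Lemma span_seqP (s : seq V) x : submodule_set (span [set x | x \in s]) x <->
  exists a : 'I_(size s) -> R, x = \sum_i a i *: s`_i.
Proof.
split=> [|[a ->]]; last first.
  apply: (submod_sum (submoduleP _)) => i; apply: (submodZ (submoduleP _)).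
  by apply: subset_span; apply: mem_nth.
move: x; apply: (@span_min [set x | x \in s]
  [set x | exists a : 'I_(size s) -> R, x = \sum_i a i *: s`_i]).
  split=> [|c _ _ [a ->] [b ->]].
    by exists (fun=> 0); rewrite big1// => i _; rewrite scale0r.
  exists (fun i => c * a i + b i); rewrite scaler_sumr -big_split/=.
  by apply: eq_bigr => i _; rewrite scalerDl scalerA.
move=> x /= xs; have ix : (index x s < size s)%N by rewrite index_mem.
exists (fun i => (i == Ordinal ix)%:R).
rewrite (bigD1 (Ordinal ix))//= eqxx scale1r nth_index// big1 ?addr0//.
by move=> i /negbTE ->; rewrite scale0r.
Qed.

End Submodules.

Lemma ideal_pow_submod (R : comNzRingType) (I : set R^o) n :
  is_submodule (ideal_pow I n).
Proof. by case: n => [|n]; [exact: submod_setT|exact: submoduleP]. Qed.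

Section Local.
Variables (R : comNzRingType) (m : ideal R).
Hypothesis mloc : local_ring m.

Lemma local_proper : ~ submodule_set m 1.
Proof.
have [_ [mT _] _] := mloc; move=> m1; apply: mT; apply/seteqP; split=> // a _.
by rewrite -[a](mulr1 a); apply: (submodZ (submoduleP m)).
Qed.

Lemma local_unit (a : R) : ~ submodule_set m a -> exists b : R, b * a = 1.
Proof.
move=> ma; apply: contrapT => nua.
pose I : set R^o := [set x | exists b : R, x = b * a].
have Isub : is_submodule I.
  split; first by exists 0; rewrite mul0r.
  move=> c _ _ [b ->] [d ->]; exists (c * b + d).
  by rewrite mulrDl -mulrA.
(* The property is imposed on the union of I and A, not on A: Zorn's lemma also asks it of the union
   of the empty chain, which is the empty set. *)
pose P (A : set R^o) := is_submodule (I `|` A) /\ ~ (I `|` A) 1.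
have [|A [[As A1] maxA]] := @Zorn_bigcup R^o P.
  move=> F FP Ftot; split; last first.
    by case=> [[b b1]|[A FA A1]]; [apply: nua; exists b|
      by case: (FP _ FA) => _; apply; right].
  split=> [|c x y]; first by left; exact: submod0.
  have memU A : F A -> I `|` A `<=` I `|` \bigcup_(X in F) X.
    by move=> FA z [Iz|Az]; [left|right; exists A].
  move=> [Ix|[A FA Ax]] [Iy|[B FB By]].
  - by left; apply: Isub.2.
  - by apply: (memU _ FB); apply: (FP _ FB).1.2; [left|right].
  - by apply: (memU _ FA); apply: (FP _ FA).1.2; [right|left].
  - case: (Ftot _ _ FA FB) => AB.
      by apply: (memU _ FB); apply: (FP _ FB).1.2; right => //; apply: AB.
    by apply: (memU _ FA); apply: (FP _ FA).1.2; right => //; apply: AB.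
have [_ _ muniq] := mloc; apply: ma.
rewrite -(muniq (Submodule As)); first by left; exists 1; rewrite mul1r.
split=> [/= IT|J /= IJ]; first by apply: A1; rewrite IT.
have [/eqP JT|/eqP JT] := boolP ((J : set R^o) == setT); [by right|left].
apply/seteqP; split=> // x Jx; right.
apply: contrapT => Ax.
apply: (maxA J); last first.
  have IJ' : I `|` J = J :> set R^o.
    by apply/seteqP; split=> [z [Iz|//]|z Jz]; [apply: IJ; left|right].
  rewrite /P IJ'; split; first exact: submoduleP.
  move=> J1; apply: JT; apply/seteqP; split=> // z _.
  by rewrite -[z](mulr1 z); apply: (submodZ (submoduleP J)).
split; last by move=> JA; apply: Ax; apply: JA.
by move=> z Az; apply: IJ; right.
Qed.

End Local.

(** * Ranks of subquotients *)

Section DetMod.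
Variables (R : comNzRingType) (m : ideal R).
Hypothesis m1 : ~ submodule_set m 1.

Let mpred : R -> bool := fun a => `[< submodule_set m a >].

Let mpred_ideal : idealr_closed mpred.
Proof.
have [m0 mP] := submoduleP m; split.
- exact/asboolP.
- by apply/asboolP.
- move=> a x y /asboolP mx /asboolP my; apply/asboolP; exact: mP.
Qed.

HB.instance Definition _ := isIdealr.Build R mpred mpred_ideal.

Let Q : comNzRingType := {ideal_quot (Idealr.clone R mpred _)}.
Let pi : {rmorphism R -> Q} := \pi_Q%qT.

Let pi_eq a b : submodule_set m (a - b) -> pi a = pi b.
Proof. by move=> mab; apply/eqP; rewrite -Quotient.idealrBE; apply/asboolP. Qed.

(** If n < p, padding [B] with zero columns and [A] with zero rows leaves the product unchanged, so
    its determinant is 0; modulo m it is 1, and R/m is not the zero ring. *)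
Lemma mulmx_unit_mod_le n p (A : 'M[R]_(n, p)) (B : 'M[R]_(p, n)) :
  (forall i j, submodule_set m ((B *m A) i j - (1%:M : 'M_p) i j)) -> (p <= n)%N.
Proof.
move=> BA1; rewrite leqNgt; apply/negP => np.
have detBA : \det (map_mx pi (B *m A)) = 1.
  rewrite -(det1 Q p); congr (\det _); rewrite -[RHS](map_mx1 pi).
  by apply/matrixP => i j; rewrite [LHS]mxE [RHS]mxE; apply: pi_eq.
have /subnKC def_p : (n <= p)%N by exact: ltnW.
have pn : (0 < p - n)%N by rewrite subn_gt0.
case: _ / def_p A B {BA1} detBA => A B detBA.
pose B' : 'M_(n + (p - n)) := row_mx B 0.
have BA : B *m A = B' *m (col_mx A 0) by rewrite mul_row_col mul0mx addr0.
move: detBA; rewrite BA map_mxM det_mulmx.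
rewrite (expand_det_col _ (rshift n (Ordinal pn))) big1 ?mul0r => [/eqP|i _].
  by rewrite eq_sym oner_eq0.
by rewrite mxE row_mxEr mxE rmorph0 mul0r.
Qed.
End DetMod.

Section Rank.
Variables (R : comNzRingType) (m : ideal R).
Implicit Types V W : lmodType R.

Definition generates V (A B : set V) n (v : 'I_n -> V) : Prop :=
  (forall i, A (v i)) /\
  forall x, A x -> exists a : 'I_n -> R, B (x - \sum_i a i *: v i).

Definition independent V (B : set V) n (v : 'I_n -> V) : Prop :=
  forall a : 'I_n -> R, B (\sum_i a i *: v i) -> forall i, submodule_set m (a i).

(** Allows bases indexed by a sum or a product of finite types, as needed for the additivity of
    ranks and for the rank of a power. *)
Lemma has_rank_fin V (A B : set V) (I : finType) (v : I -> V) :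
  (forall i, A (v i)) ->
  (forall x, A x -> exists a : I -> R, B (x - \sum_i a i *: v i)) ->
  (forall a : I -> R, B (\sum_i a i *: v i) -> forall i, submodule_set m (a i)) ->
  has_rank m A B #|I|.
Proof.
move=> Av gen ind; exists (v \o enum_val).
have sumE (a : I -> R) :
    \sum_i a i *: v i = \sum_(i < #|I|) a (enum_val i) *: v (enum_val i).
  rewrite (reindex _ (onW_bij _ (enum_val_bij I))).
  by apply: eq_bigr.
split=> [i|x /gen[a aB]|a aB i]; first exact: Av.
  by exists (a \o enum_val); rewrite sumE in aB.
rewrite -(enum_valK i); apply: (ind (a \o enum_rank)).
by rewrite sumE; under eq_bigr do rewrite /= enum_valK.
Qed.

Lemma has_rank0P V (A B : set V) : A `<=` B -> has_rank m A B 0.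
Proof.
move=> AB; exists (fun=> 0); split=> [[]//|x /AB Bx|a _ []//].
by exists (fun=> 0); rewrite big_ord0 subr0.
Qed.

Lemma has_rank0 V (A B : set V) : has_rank m A B 0 -> A `<=` B.
Proof. by move=> [v [_ gen _]] x /gen[a]; rewrite big_ord0 subr0. Qed.

Section Unique.
Hypothesis m1 : ~ submodule_set m 1.

(** Writing the [w] through the [v] and back multiplies two coefficient matrices; independence of
    [w] forces the product to be the identity modulo m. *)
Lemma independent_le V (A B : set V) n p (v : 'I_n -> V) (w : 'I_p -> V) :
  is_submodule B -> generates A B v -> (forall i, A (w i)) -> independent B w ->
  (forall i, exists a : 'I_p -> R, B (v i - \sum_j a j *: w j)) ->
  (p <= n)%N.
Proof.
move=> Bs [_ gen] Aw ind gen'.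
have /choice[a aB] := gen'.
have /choice[b bB] : forall j, exists c : 'I_n -> R, B (w j - \sum_i c i *: v i).
  by move=> j; apply: gen.
apply: (@mulmx_unit_mod_le R m m1 n p (\matrix_(i, j) a i j) (\matrix_(i, j) b i j)).
move=> j; apply: (ind (fun k => _)).
under eq_bigr do rewrite scalerBl.
rewrite sumrB [X in _ - X](bigD1 j)//= [1%:M j j]mxE eqxx scale1r.
rewrite (big1 _ (fun i => i != j)) ?addr0 => [|i ij]; last first.
  by rewrite mxE eq_sym (negbTE ij) scale0r.
rewrite -opprB; apply: submodN => //.
rewrite -(subrKA (\sum_i b j i *: v i)); apply: submodD => //.
have -> : \sum_i (\matrix_(i0, j0) b i0 j0 *m \matrix_(i0, j0) a i0 j0) j i *: w i =
   \sum_i b j i *: \sum_k a i k *: w k.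
  under eq_bigr do rewrite mxE scaler_suml.
  rewrite exchange_big; apply: eq_bigr => i _ /=.
  rewrite scaler_sumr; apply: eq_bigr => k _.
  by rewrite !mxE scalerA.
rewrite -sumrB; apply: submod_sum => // i.
by rewrite -scalerBr; apply: submodZ.
Qed.

Lemma has_rank_uniq V (A B : set V) n p : is_submodule B ->
  has_rank m A B n -> has_rank m A B p -> n = p.
Proof.
move=> Bs [v [Av gv iv]] [w [Aw gw iw]]; apply/eqP; rewrite eqn_leq.
rewrite (@independent_le V A B p n w v)//=; last by move=> i; apply: gv.
by apply: (@independent_le V A B n p v w) => // i; apply: gw.
Qed.

Lemma rankE V (A B : set V) n : is_submodule B ->
  has_rank m A B n -> rank m A B = n.
Proof.
by move=> Bs ABn; apply: xget_unique => // p ABp; apply: has_rank_uniq ABn.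
Qed.

End Unique.

Lemma has_rank_add V (A B C : set V) n p :
  is_submodule A -> is_submodule B -> is_submodule C -> C `<=` B -> B `<=` A ->
  (forall a x, submodule_set m a -> A x -> C (a *: x)) ->
  has_rank m A B n -> has_rank m B C p -> has_rank m A C (n + p).
Proof.
move=> As Bs Cs CB BA mAC [v [Av gv iv]] [w [Bw gw iw]].
rewrite -[n]card_ord -[p]card_ord -card_sum.
pose u (i : 'I_n + 'I_p) := match i with inl i => v i | inr j => w j end.
have sumE (a : 'I_n + 'I_p -> R) : \sum_i a i *: u i =
    \sum_i a (inl i) *: v i + \sum_j a (inr j) *: w j by rewrite big_sumType.
apply: (@has_rank_fin _ _ _ _ u).
- by case=> [i|j] /=; [exact: Av|exact: BA].
- move=> x /gv[a /gw[b abC]].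
  exists (fun i => match i with inl i => a i | inr j => b j end).
  by rewrite sumE /= opprD addrA.
- move=> a; rewrite sumE => aC.
  have ma i : submodule_set m (a (inl i)).
    apply: (iv (fun i => a (inl i))).
    apply: (submod_subl Bs (y := - \sum_j a (inr j) *: w j)).
      by rewrite opprK; apply: CB.
    by apply: submodN => //; apply: submod_sum => // j; apply: submodZ.
  case=> [//|j]; apply: (iw (fun j => a (inr j))).
  rewrite -(addKr (\sum_i a (inl i) *: v i) (\sum_j _)) addrC.
  apply: submodB => //; apply: submod_sum => // i; exact: mAC.
Qed.

Lemma has_rank_image V W (f : {linear V -> W}) (A B : set V) (A' B' : set W) n :
  is_submodule A -> (forall x, A x -> A' (f x)) ->
  (forall x, B x -> B' (f x)) -> (forall x, A x -> B' (f x) -> B x) ->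
  is_submodule B' ->
  (forall y, A' y -> exists2 x, A x & B' (y - f x)) ->
  has_rank m A B n -> has_rank m A' B' n.
Proof.
move=> As AA' BB' B'B Bs' surj [v [Av gv iv]].
have fsum (a : 'I_n -> R) : f (\sum_i a i *: v i) = \sum_i a i *: f (v i).
  by rewrite linear_sum; apply: eq_bigr => i _; rewrite linearZ.
exists (f \o v); split=> [i|y /surj[x Ax yx]|a B'a].
- exact: AA'.
- have [a aB] := gv x Ax; exists a.
  rewrite -fsum -(subrKA (f x)) -linearB; apply: submodD => //.
  exact: BB'.
- apply: iv; apply: B'B; last by rewrite fsum.
  by apply: submod_sum => // i; apply: submodZ.
Qed.

Section Exists.
Hypothesis mloc : local_ring m.

(** In a local ring a family that is not independent satisfies a relation with a unit coefficient,
    which eliminates one generator. Nothing forces A / B to be killed by m: for B = 0 the result is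
    a minimal generating family, all of whose relations have coefficients in m. *)
Lemma generates_basis V (A B : set V) n (v : 'I_n -> V) : is_submodule B ->
  generates A B v -> exists2 p, (p <= n)%N & has_rank m A B p.
Proof.
move=> Bs; elim: n v => [|n IH] v [Av gv].
  by exists 0%N => //; exists v; split=> // a _ [].
have [iv|] := pselect (independent B v).
  by exists n.+1 => //; exists v.
move=> /existsNP[a /not_implyP[aB /existsNP[i0 /(local_unit mloc)[u ua]]]].
have [|p pn Ap] := IH (v \o lift i0); last by exists p => //; exact: leqW.
split=> [i|x /gv[b bB]]; first exact: Av.
(* Subtracting this multiple of the relation makes the coefficient at [i0] vanish, since
   [u * a i0 = 1]. *)
pose c i := b i - b i0 * u * a i.
exists (c \o lift i0).
have -> : x - \sum_i (c \o lift i0) i *: (v \o lift i0) i =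
   (x - \sum_i b i *: v i) + (b i0 * u) *: (\sum_i a i *: v i).
  have c0 : c i0 = 0 by rewrite /c -mulrA ua mulr1 subrr.
  suff -> : \sum_i (c \o lift i0) i *: (v \o lift i0) i =
      \sum_i b i *: v i - (b i0 * u) *: (\sum_i a i *: v i).
    by rewrite opprB addrCA addrC.
  rewrite scaler_sumr -sumrB (bigD1_ord i0)//=.
  rewrite -[LHS]add0r; congr (_ + _).
    by rewrite scalerA -scalerBl -[X in X *: _]/(c i0) c0 scale0r.
  by apply: eq_bigr => i _; rewrite scalerA -scalerBl.
by apply: submodD => //; apply: submodZ.
Qed.

End Exists.
End Rank.

(** * Submodules of free modules *)

Section Rows.
Variable R : comNzRingType.
Implicit Types I J : set R^o.

Definition rows I p : set 'rV[R]_p := [set x | forall j, I (x 0 j)].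
Arguments rows I p : clear implicits.

Lemma rows_submod I p : is_submodule I -> is_submodule (rows I p).
Proof.
move=> Is; split=> [j|a x y Ix Iy j]; rewrite !mxE; first exact: (submod0 Is).
exact: (Is.2).
Qed.

Lemma ideal_smul_rows I p : is_submodule I ->
  ideal_smul I [set: 'rV[R]_p] = rows I p :> set _.
Proof.
move=> Is; apply/seteqP; split.
  apply: ideal_smul_min => [|a x Ia _ j]; first exact: rows_submod.
  by rewrite mxE mulrC; apply: submodZ.
move=> x Ix; rewrite [x]row_sum_delta; apply: submod_sum => [|j].
  exact: submoduleP.
exact: ideal_smulZ.
Qed.

Lemma is_submodule_range_mul s p (K : 'M[R]_(s, p)) :
  is_submodule (range (fun y : 'rV_s => y *m K)).
Proof. exact: (range_subproof (mulmxr K)). Qed.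

(** Induction on p: the first coordinates of W form an ideal, and the rows of W with first
    coordinate 0 form a submodule of R^p. Lifts of generators of the former together with generators
    of the latter generate W. *)
Lemma noetherian_rows : noetherian_ring R -> forall p (W : set 'rV[R]_p),
  is_submodule W -> exists s (K : 'M[R]_(s, p)), W = range (fun y : 'rV_s => y *m K).
Proof.
move=> noeth; elim=> [|p IH]; first move=> W Ws.
  exists 0%N, 0; apply/seteqP; split=> x _.
    by exists 0 => //; rewrite !thinmx0.
  by rewrite [x]thinmx0; exact: submod0.
change (forall W : set 'rV[R]_(1 + p), is_submodule W ->
  exists s (K : 'M[R]_(s, 1 + p)), W = range (fun y : 'rV_s => y *m K)).
move=> W Ws; pose W' : set 'rV[R]_p := [set y | W (row_mx (0 : 'rV_1) y)].
have [|s' [K' WK']] := IH W'.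
  split=> [|a x y Wx Wy]; first by rewrite /W'/= row_mx0; exact: submod0.
  rewrite /W'/=.
  have -> : row_mx (0 : 'rV_1) (a *: x + y) =
      a *: row_mx (0 : 'rV_1) x + row_mx 0 y.
    by rewrite scale_row_mx add_row_mx scaler0 addr0.
  exact: Ws.2.
pose I : set R^o := [set a : R^o | exists2 x : 'rV_(1 + p), W x & lsubmx x = a%:M].
have Is : is_submodule I.
  split=> [|a b c [x Wx xb] [y Wy yc]].
    by exists 0; [exact: submod0|rewrite !raddf0].
  exists (a *: x + y); first exact: Ws.2.
  by rewrite linearP /= xb yc raddfD /= scale_scalar_mx.
have [l Il] := noeth (Submodule Is).
have /choice[t tP] : forall i : 'I_(size l),
    exists x : 'rV_(1 + p), W x /\ lsubmx x = (l`_i)%:M.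
  move=> i; suff [x Wx xi] : I l`_i by exists x.
  by rewrite [I]Il; apply: subset_span; apply: mem_nth.
pose T := \matrix_i t i.
exists (size l + s')%N, (col_mx T (row_mx (0 : 'M_(s', 1)) K')).
apply/seteqP; split=> [x Wx|_ [y _ <-]]; last first.
  rewrite mulmx_sum_row; apply: submod_sum => // i; apply: submodZ => //.
  case: (split_ordP i) => {}i ->.
    by rewrite rowKu rowK; case: (tP i).
  rewrite rowKd [row _ _](@row_row_mx _ _ 1 p) row0.
  have : W' (row i K') by rewrite WK'; exists (delta_mx 0 i); rewrite -?rowE.
  by [].
have : I (lsubmx (x : 'rV_(1 + p)) 0 0) by exists x => //; exact: mx11_scalar.
rewrite [I]Il => /span_seqP[a xa].
pose c := \row_i a i.
pose x' : 'rV_(1 + p) := x - c *m T.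
have Wx' : W x'.
  apply: submodB => //; rewrite mulmx_sum_row; apply: submod_sum => // i.
  by apply: submodZ => //; rewrite rowK; case: (tP i).
have lx' : lsubmx x' = 0.
  rewrite linearB /= [lsubmx x]mx11_scalar xa mulmx_sum_row linear_sum /=.
  rewrite raddf_sum -sumrB big1// => i _.
  rewrite linearZ /= rowK (tP i).2 mxE scale_scalar_mx.
  exact: subrr.
have : W' (rsubmx x').
  by rewrite /W' /= -lx' hsubmxK.
rewrite WK' => -[y _ yx]; exists (row_mx c y) => //.
rewrite mul_row_col mul_mx_row mulmx0 yx -lx' hsubmxK.
by rewrite addrC subrK.
Qed.

Variable m : ideal R.
Hypothesis mloc : local_ring m.

(** The kernel of [K] lies in m R^s, so any map whose image is this kernel is a minimal
    differential. *)
Lemma minimal_generators p (W : set 'rV[R]_p) : is_submodule W ->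
  exists s (K : 'M[R]_(s, p)), W = range (fun y : 'rV_s => y *m K) /\
    forall y : 'rV_s, y *m K = 0 -> rows m s y.
Proof.
move=> Ws; have [noeth _ _] := mloc.
have [s [K WK]] := noetherian_rows noeth Ws.
have [||q _ [v [Wv gv iv]]] :=
    @generates_basis _ m mloc _ W [set 0] s (fun i => row i K).
- exact: submod_zero.
- split=> [i|x]; first by rewrite WK rowE; exists (delta_mx 0 i).
  rewrite WK => -[y _ <-]; exists (fun i => y 0 i).
  by rewrite /= mulmx_sum_row subrr.
- have sumE (a : 'rV_q) : a *m (\matrix_i v i) = \sum_i a 0 i *: v i.
    by rewrite mulmx_sum_row; under eq_bigr do rewrite rowK.
  exists q, (\matrix_i v i); split.
    apply/seteqP; split=> [x /gv[a /= /subr0_eq ->]|_ [y _ <-]].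
      exists (\row_i a i) => //; rewrite sumE.
      by apply: eq_bigr => i _; rewrite mxE.
    by rewrite sumE; apply: submod_sum => // i; apply: submodZ.
  by move=> y; rewrite sumE => y0 i; apply: (iv (fun i => y 0 i)).
Qed.

Lemma has_rank_rows I J p n : is_submodule I -> is_submodule J ->
  has_rank m I J n -> has_rank m (rows I p) (rows J p) (p * n)%N.
Proof.
move=> Is Js [v [Iv gv iv]].
rewrite -[p in (p * _)%N]card_ord -[n]card_ord -card_prod.
pose u (i : 'I_p * 'I_n) : 'rV[R]_p := v i.2 *: delta_mx 0 i.1.
have sumE (a : 'I_p * 'I_n -> R) j :
    (\sum_i a i *: u i) 0 j = \sum_k a (j, k) *: v k.
  rewrite summxE (eq_bigr (fun i => (a (i.1, i.2) *: u (i.1, i.2)) 0 j));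
    last by case.
  rewrite -(pair_bigA _ (fun i k => (a (i, k) *: u (i, k)) 0 j))/=.
  rewrite (bigD1 j)//= [X in _ + X]big1 ?addr0 => [|i /negbTE ij].
    by apply: eq_bigr => k _; rewrite !mxE !eqxx mulr1.
  by rewrite big1// => k _; rewrite !mxE eq_sym ij andbF !mulr0.
apply: (@has_rank_fin _ _ _ _ _ _ u) => [[i k] j|x Ix|a aJ [i k]].
- rewrite !mxE /=; case: eqP => _; rewrite ?mulr1 ?mulr0//; exact: (submod0 Is).
- have /choice[a aJ] : forall j, exists a : 'I_n -> R,
      J ((x 0 j : R^o) - \sum_k a k *: v k) by move=> j; apply: gv.
  exists (fun i => a i.1 i.2) => j.
  rewrite /= mxE [X in _ + X]mxE (sumE (fun i => a i.1 i.2)); exact: aJ.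
- by apply: (iv (fun k => a (i, k))); rewrite -sumE.
Qed.

End Rows.
Arguments rows {R} I p.

(** * Minimal resolutions and their comparison *)

Section MinimalResolution.
Variables (R : comNzRingType) (m : ideal R).
Hypothesis mloc : local_ring m.

(* The target of [next_stage S] is convertible to the source of [S], so that
   the matrices of [stages] have the types required of a differential. *)
Record stage := Stage { src : nat; tgt : nat; smx : 'M[R]_(src, tgt) }.

Lemma kernel_cover (S : stage) : exists sK : {s & 'M[R]_(s, src S)},
  [set x | x *m smx S = 0] = range (fun y : 'rV_(projT1 sK) => y *m projT2 sK) /\
  forall y : 'rV_(projT1 sK), y *m projT2 sK = 0 -> rows m _ y.
Proof.
have [|s [K [WK mK]]] := minimal_generators mloc (W := [set x | x *m smx S = 0]).
  split=> [|a x y /= x0 y0]; first by rewrite /= mul0mx.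
  by rewrite mulmxDl -scalemxAl x0 y0 scaler0 addr0.
by exists (existT _ s K).
Qed.

Definition next_stage (S : stage) : stage :=
  Stage (projT2 (projT1 (cid (kernel_cover S)))).

Lemma next_stageP (S : stage) :
  [set x : 'rV_(src S) | x *m smx S = 0] =
  range (fun y : 'rV_(src (next_stage S)) => y *m smx (next_stage S)).
Proof. by rewrite /next_stage; case: cid => sK /= [-> _]. Qed.

Lemma next_stage_min (S : stage) (y : 'rV_(src (next_stage S))) :
  y *m smx (next_stage S) = 0 -> rows m _ y.
Proof. by move: y; rewrite /next_stage; case: cid => sK /= [_]. Qed.

Fixpoint stages (S : stage) n : stage :=
  if n is n'.+1 then next_stage (stages S n') else S.

Variable M : lmodType R.

Section Combination.
Variables (n : nat) (v : 'I_n -> M).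

Definition combination (x : 'rV[R]_n) : M := \sum_i x 0 i *: v i.

Lemma combination_linear : linear combination.
Proof.
move=> a x y; rewrite /combination scaler_sumr -big_split /=.
by apply: eq_bigr => i _; rewrite !mxE scalerDl scalerA.
Qed.

HB.instance Definition _ :=
  GRing.isLinear.Build R 'rV[R]_n M _ combination combination_linear.

End Combination.

Lemma minimal_resolution_exists : finite_module M ->
  exists F : free_resolution M, minimal_resolution m F.
Proof.
move=> [s /seteqP[sT _]].
have [||f _ [v [_ gv iv]]] :=
    @generates_basis R m mloc M [set: M] [set 0] (size s) (fun i => s`_i).
- exact: submod_zero.
- split=> // x _; have /span_seqP[a ->] := sT x Logic.I.
  by exists a; rewrite /= subrr.
pose e : {linear 'rV[R]_f -> M} := combination v.
have esurj : range e = [set: M].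
  apply/seteqP; split=> // x _; have [a /= /subr0_eq ->] := gv x Logic.I.
  exists (\row_i a i) => //; apply: eq_bigr => i _; by rewrite mxE.
have emin x : e x = 0 -> rows m f x by move=> ex; exact: (iv (fun i => x 0 i)).
have [|p [K [eK mK]]] := minimal_generators mloc (W := [set x | e x = 0]).
  split=> [|a x y ex ey]; first exact: (linear0 e).
  apply: (etrans (linearP e a x y)).
  by rewrite (ex : e x = 0) (ey : e y = 0) scaler0 addr0.
pose S := Stage K; pose st := stages S.
have stmin n (y : 'rV_(src (st n))) : y *m smx (st n) = 0 -> rows m _ y.
  by case: n y => [|n] y /=; [exact: mK|exact: next_stage_min].
exists (@FreeResolution R M (fun n => tgt (st n)) (fun n => smx (st n)) e esurj
  eK (fun n => next_stageP (st n))).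
move=> n _ [y _ <-].
rewrite (ideal_smul_rows _ (submoduleP m)).
case: n y => [|n] y.
  by apply: emin; rewrite -[_ = 0]/([set x | e x = 0] _) eK; exists y.
apply: (stmin n); rewrite -[_ = 0]/([set x | x *m smx (st n) = 0] _) next_stageP.
by exists y.
Qed.

End MinimalResolution.

Section ResolutionBasics.
Variables (R : comNzRingType) (M : lmodType R) (F : free_resolution M).

Lemma augm_dmx (y : 'rV_(frank F 1)) : augm F (y *m dmx F 0) = 0.
Proof. by rewrite -[_ = 0]/([set x | augm F x = 0] _) augm_exact; exists y. Qed.

Lemma augm_ker (x : 'rV_(frank F 0)) : augm F x = 0 ->
  exists y : 'rV_(frank F 1), y *m dmx F 0 = x.
Proof.
by rewrite -[_ = 0]/([set x | augm F x = 0] _) augm_exact => -[y _ <-]; exists y.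
Qed.

Lemma augm_lift y : exists x, augm F x = y.
Proof.
by have : range (augm F) y by [rewrite augm_surj]; case=> x _ <-; exists x.
Qed.

Lemma dmx_dmx n : dmx F n.+1 *m dmx F n = 0.
Proof.
apply/row_matrixP => i; rewrite row0 row_mul rowE.
rewrite -[_ = 0]/([set x | x *m dmx F n = 0] _) diff_exact.
by exists (delta_mx 0 i).
Qed.

Lemma dmx_ker n (x : 'rV_(frank F n.+1)) : x *m dmx F n = 0 ->
  exists y : 'rV_(frank F n.+2), y *m dmx F n.+1 = x.
Proof.
rewrite -[_ = 0]/([set x | x *m dmx F n = 0] _) diff_exact => -[y _ <-].
by exists y.
Qed.

End ResolutionBasics.

Section Comparison.
Variable R : comNzRingType.

Lemma mulmx_lift p q s (B : 'M[R]_(p, q)) (K : 'M[R]_(s, q)) :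
  (forall i, exists y, y *m K = row i B) -> exists X, X *m K = B.
Proof.
move=> /choice[y yK]; exists (\matrix_i y i).
by apply/row_matrixP => i; rewrite row_mul rowK.
Qed.

Variable M : lmodType R.

Section Maps.
Variables F G : free_resolution M.

Definition chain_map (u : forall n, 'M[R]_(frank F n, frank G n)) : Prop :=
  (forall x, augm G (x *m u 0%N) = augm F x) /\
  forall n, u n.+1 *m dmx G n = dmx F n *m u n.

Lemma chain_map_exists : exists u, chain_map u.
Proof.
have [y yE] := choice (fun i => augm_lift G (augm F (delta_mx 0 i))).
pose u0 := \matrix_i y i.
(* The choice has default 0 when no lift exists. The recursion can thus be written down before
   commutation at the previous stage, on which the existence of a lift depends, is known. *)
pose step n (u : 'M[R]_(frank F n, frank G n)) : 'M_(frank F n.+1, frank G n.+1) :=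
  xget 0 [set X | X *m dmx G n = dmx F n *m u].
have stepP n (v : 'M_(frank F n, frank G n)) :
    (forall i, exists y, y *m dmx G n = row i (dmx F n *m v)) ->
    step n v *m dmx G n = dmx F n *m v.
  move=> /mulmx_lift; exact: (@xgetPex _ 0 [set X | X *m dmx G n = dmx F n *m v]).
pose u := fix u n : 'M[R]_(frank F n, frank G n) :=
  if n is n'.+1 then step n' (u n') else u0.
have u0E x : augm G (x *m u0) = augm F x.
  rewrite mulmx_sum_row {2}[x]row_sum_delta !linear_sum; apply: eq_bigr => i _.
  by rewrite !linearZ /= rowK yE.
exists u; split=> // n; apply: (stepP) => i.
rewrite rowE !mulmxA; case: n i => [|n] i.
  by apply: augm_ker; rewrite u0E augm_dmx.
apply: dmx_ker.
suff uE : u n.+1 *m dmx G n = dmx F n *m u n.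
  by rewrite -mulmxA uE mulmxA -(mulmxA _ _ (dmx F _)) dmx_dmx mulmx0 mul0mx.
clear i; elim: n => [|n IH]; apply: stepP => j.
  by rewrite rowE !mulmxA; apply: augm_ker; rewrite u0E augm_dmx.
rewrite rowE !mulmxA; apply: dmx_ker.
by rewrite -mulmxA IH mulmxA -(mulmxA _ _ (dmx F _)) dmx_dmx mulmx0 mul0mx.
Qed.

Lemma chain_homotopy u w : chain_map u -> chain_map w ->
  exists h : forall n, 'M[R]_(frank F n, frank G n.+1),
    u 0%N - w 0%N = h 0%N *m dmx G 0 /\
    forall n, u n.+1 - w n.+1 = h n.+1 *m dmx G n.+1 + dmx F n *m h n.
Proof.
move=> [u0 uS] [w0 wS].
have [h0 h0E] : exists X, X *m dmx G 0 = u 0%N - w 0%N.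
  apply: mulmx_lift => i; apply: augm_ker.
  by rewrite rowE mulmxBr linearB /= u0 w0 subrr.
pose step n (h : 'M[R]_(frank F n, frank G n.+1)) :
    'M_(frank F n.+1, frank G n.+2) :=
  xget 0 [set X | X *m dmx G n.+1 = u n.+1 - w n.+1 - dmx F n *m h].
pose h := fix h n : 'M[R]_(frank F n, frank G n.+1) :=
  if n is n'.+1 then step n' (h n') else h0.
have stepP n : dmx F n *m (u n - w n - h n *m dmx G n) = 0 ->
    h n.+1 *m dmx G n.+1 = u n.+1 - w n.+1 - dmx F n *m h n.
  move=> hn; apply: (@xgetPex _ 0
    [set X | X *m dmx G n.+1 = u n.+1 - w n.+1 - dmx F n *m h n]).
  apply: mulmx_lift => i; apply: dmx_ker.
  rewrite rowE -mulmxA mulmxBl mulmxBl uS wS -mulmxBr -mulmxA -mulmxBr.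
  by rewrite hn mulmx0.
exists h; split=> // n.
suff -> : h n.+1 *m dmx G n.+1 = u n.+1 - w n.+1 - dmx F n *m h n by rewrite subrK.
elim: n => [|n IH]; apply: stepP; first by rewrite -h0E subrr mulmx0.
by rewrite IH subKr mulmxA dmx_dmx mul0mx.
Qed.

End Maps.

Lemma chain_map_id F : chain_map (fun n => 1%:M : 'M[R]_(frank F n)).
Proof. by split=> [x|n]; rewrite ?mulmx1// mul1mx. Qed.

Lemma chain_map_comp F G H u w : @chain_map F G u -> @chain_map G H w ->
  chain_map (fun n => u n *m w n).
Proof.
move=> [u0 uS] [w0 wS]; split=> [x|n]; first by rewrite mulmxA w0 u0.
by rewrite -mulmxA wS !mulmxA uS.
Qed.

End Comparison.

(** * Independence of Ext from the resolution *)

Section Ext.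
Variables (R : comNzRingType) (M N : lmodType R).

Lemma ext_cocycles_submod (F : free_resolution M) n :
  is_submodule (ext_cocycles F N n).
Proof.
split.
  by split=> [a x y|x]; rewrite ?fctE /= ?scaler0 ?addr0.
move=> a f g [fl f0] [gl g0].
have E z : (a *: f + g) z = a *: f z + g z by [].
split=> [c x y|x]; rewrite !E.
  by rewrite fl gl !scalerDr !scalerA mulrC addrACA.
by rewrite f0 g0 scaler0 addr0.
Qed.

Lemma ext_coboundaries_submod (F : free_resolution M) n :
  is_submodule (ext_coboundaries F N n).
Proof.
case: n => [|n] /=; first exact: submod_zero.
split; first by exists (fun=> 0) => // a x y; rewrite scaler0 addr0.
move=> a _ _ [f fl ->] [g gl ->]; exists (a *: f + g) => //.
have E z : (a *: f + g) z = a *: f z + g z by [].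
move=> c x y; rewrite !E.
by rewrite fl gl !scalerDr !scalerA mulrC addrACA.
Qed.

Variables F G : free_resolution M.

Definition pullback n (u : 'M[R]_(frank F n, frank G n)) (f : chain G n -> N) :
  chain F n -> N := fun x => f (x *m u).

Lemma pullback_linear n u : linear (@pullback n u).
Proof. by []. Qed.

HB.instance Definition _ n u := GRing.isLinear.Build R _ _ _ (@pullback n u)
  (@pullback_linear n u).

End Ext.

Section ExtComparison.
Variables (R : comNzRingType) (M N : lmodType R).
Implicit Types F G : free_resolution M.

Lemma pullback_cocycles F G u n f : @chain_map R M F G u ->
  ext_cocycles G N n f -> ext_cocycles F N n (pullback (u n) f).
Proof.
move=> [u0 uS] [fl f0]; split=> [a x y|x].
  by rewrite /pullback mulmxDl -scalemxAl fl.
have := f0 (x *m u n.+1); rewrite /bd /= /mulmxr/= -mulmxA uS mulmxA.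
exact.
Qed.

Lemma pullback_coboundaries F G u n f : @chain_map R M F G u ->
  ext_coboundaries G N n f -> ext_coboundaries F N n (pullback (u n) f).
Proof.
case: n f => [|n] f [u0 uS] /=; first by move=> ->.
move=> [g gl ->]; exists (pullback (u n) g).
  by move=> a x y; rewrite /pullback mulmxDl -scalemxAl gl.
by apply/funext => x; rewrite /pullback /= /mulmxr/= -!mulmxA uS.
Qed.

Lemma pullback_homotopic F u n f : @chain_map R M F F u ->
  ext_cocycles F N n f -> ext_coboundaries F N n (f - pullback (u n) f).
Proof.
move=> cu [fl f0].
have [h [h0 hS]] := chain_homotopy (chain_map_id F) cu.
pose fL := GRing.isLinear.Build R _ _ _ f fl.
pose fl' : {linear _ -> _} := HB.pack f fL.
have fB x y : f (x - y) = f x - f y := raddfB fl' x y.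
have fD x y : f (x + y) = f x + f y := raddfD fl' x y.
case: n f fl f0 {fL fl'} fB fD => [|n] f fl f0 fB fD.
  apply/funext => x /=; apply: (etrans (esym (fB x (x *m u 0%N)))).
  rewrite -{1}[x]mulmx1 -mulmxBr h0 mulmxA; exact: f0.
(* The other summand of the homotopy passes through [dmx F n.+1] and is killed by the cocycle
   [f]. *)
exists (fun x => f (x *m h n)).
  by move=> a x y; rewrite mulmxDl -scalemxAl fl.
apply/funext => x /=; apply: (etrans (esym (fB x (x *m u n.+1)))).
rewrite -{1}[x]mulmx1 -mulmxBr hS mulmxDr !mulmxA; apply: (etrans (fD _ _)).
by rewrite [X in X + _](f0 (x *m h n.+1)) add0r.
Qed.

Variable m : ideal R.

(** The rank of Ext may be read off on any resolution: pullbacks along comparison maps in both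
    directions are mutually inverse up to coboundaries. *)
Lemma ext_has_rank_resolution F G n b :
  has_rank m (ext_cocycles F N n) (ext_coboundaries F N n) b ->
  has_rank m (ext_cocycles G N n) (ext_coboundaries G N n) b.
Proof.
have [u cu] := chain_map_exists F G; have [w cw] := chain_map_exists G F.
apply: (@has_rank_image _ _ _ _ (pullback (w n))).
- exact: ext_cocycles_submod.
- by move=> f; apply: pullback_cocycles.
- by move=> f; apply: pullback_coboundaries.
- move=> f fZ fB; apply: (submod_subl (ext_coboundaries_submod N F n)).
    exact: (pullback_homotopic (chain_map_comp cu cw) fZ).
  have := pullback_coboundaries cu fB.
  by congr ext_coboundaries; apply/funext => x; rewrite /pullback mulmxA.
- exact: ext_coboundaries_submod.
- move=> f fZ; exists (pullback (u n) f); first exact: pullback_cocycles.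
  have := pullback_homotopic (chain_map_comp cw cu) fZ.
  by congr ext_coboundaries; apply/funext => x; rewrite /pullback /= !fctE mulmxA.
Qed.

End ExtComparison.

(** * Flat base change *)

Section Flat.
Variable R : comNzRingType.

Lemma quotient_proj_linear (V : lmodType R) (W : submodule V) :
  linear (quotient_proj W).
Proof. by move=> a x y; rewrite quotient_projD quotient_projZ. Qed.

Lemma quotient_proj_eq0 (V : lmodType R) (W : submodule V) x :
  quotient_proj W x = 0 <-> submodule_set W x.
Proof.
have <- : quotient_proj W 0 = 0.
  apply/eqP; rewrite -(subrr (quotient_proj W 0)) -subr_eq0 opprB addrA.
  by rewrite -quotient_projD addr0 subrr.
by rewrite quotient_projE subr0.
Qed.

Lemma linear_combination (V U : lmodType R) (g : V -> U) (I : finType)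
  (a : I -> R) (v : I -> V) : linear g ->
  g (\sum_i a i *: v i) = \sum_i a i *: g (v i).
Proof.
move=> glin; pose gL : {linear V -> U} :=
  HB.pack g (GRing.isLinear.Build R _ _ _ g glin).
rewrite [LHS](linear_sum gL); apply: eq_bigr => i _; exact: (linearZZ gL).
Qed.

Lemma quotient_lift (V U : lmodType R) (W : submodule V) (g : V -> U) :
  linear g -> (forall x, submodule_set W x -> g x = 0) ->
  exists f : {linear quotient_module W -> U},
    forall x, f (quotient_proj W x) = g x.
Proof.
move=> glin gW.
pose gL : {linear V -> U} := HB.pack g (GRing.isLinear.Build R _ _ _ g glin).
have [s sK] := choice (@quotient_proj_surj R V W).
have sE x : g (s (quotient_proj W x)) = g x.
  apply/eqP; rewrite -subr_eq0 -[_ - _](raddfB gL).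
  by apply/eqP/gW/quotient_projE.
have gslin : linear (g \o s).
  move=> a p q; rewrite /= -{1}[p]sK -{1}[q]sK -quotient_proj_linear sE.
  by rewrite glin.
pose f : {linear quotient_module W -> U} :=
  HB.pack (g \o s) (GRing.isLinear.Build R _ _ _ (g \o s) gslin).
by exists f.
Qed.

Variable R' : comAlgType R.
Local Notation phi := (in_alg R').
Local Notation "A ^phi" := (map_mx phi A) (at level 2, format "A ^phi").

(** Let W be the kernel of [A], so that [A] embeds R^p / W into R^q. The tensor with terms x'_i (x)
    e_i in R' (x) (R^p / W) is sent to 0, because x'A = 0; by flatness it is 0 already. Evaluating
    it under the bilinear map (r, v) -> class of (v_j r)_j, with values in R'^p modulo the row space
    of [K] over R', puts x' into that row space. The map is well defined because W lies in the row
    space of [K] over R. *)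
Lemma flat_exact p q s (A : 'M[R]_(p, q)) (K : 'M[R]_(s, p)) :
  flat_module (R' : lmodType R) ->
  (forall x : 'rV_p, x *m A = 0 -> exists y, x = y *m K) ->
  forall x' : 'rV[R']_p, x' *m A^phi = 0 -> exists y', x' = y' *m K^phi.
Proof.
move=> flat exK x' x'A.
have Wsub : is_submodule [set x : 'rV[R]_p | x *m A = 0].
  split=> [|a x y xA yA]; first exact: mul0mx.
  by rewrite /= mulmxDl -scalemxAl xA yA scaler0 addr0.
pose W := Submodule Wsub.
have [|f fE] := @quotient_lift _ _ W (mulmxr A) (linearP _) => [x //|].
have finj : injective f.
  move=> u v; have [x <-] := quotient_proj_surj u.
  have [y <-] := quotient_proj_surj v; rewrite !fE /= => xy.
  by apply/quotient_projE; rewrite /= mulmxBl xy subrr.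
(* The target of the bilinear map must be an R-module. Finite functions into R' are one pointwise,
   whereas rows over R' are scaled by R'. *)
have S0 : is_submodule [set g : {ffun 'I_p -> R'} |
    exists y' : 'rV[R']_s, forall j, g j = (y' *m K^phi) 0 j].
  split=> [|a g h [y gy] [z hz]].
    by exists 0 => j; rewrite mul0mx !mxE ffunE.
  exists (phi a *: y + z) => j.
  rewrite mulmxDl -scalemxAl [RHS]mxE [X in _ = X + _]mxE !ffunE.
  by rewrite gy hz mulr_algl.
pose S := Submodule S0.
pose g (r : R') (v : 'rV[R]_p) : quotient_module S :=
  quotient_proj S [ffun j => v 0 j *: r].
have glin r : linear (g r).
  move=> a x y; rewrite /g -quotient_proj_linear; congr quotient_proj.
  by apply/ffunP => j; rewrite !ffunE !mxE scalerDl scalerA.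
have /choice[b bE] : forall r,
    exists b : {linear quotient_module W -> quotient_module S},
    forall x, b (quotient_proj W x) = g r x.
  move=> r; apply: quotient_lift => // x /exK[y ->].
  apply/quotient_proj_eq0.
  exists (r *: map_mx phi y) => j; rewrite ffunE -scalemxAl -map_mxM !mxE.
  by rewrite mulr_algr.
pose e i := quotient_proj W (delta_mx 0 i).
have := flat _ _ f finj [seq (x' 0 i, e i) | i <- enum 'I_p].
have tens : tensor_eq0
    [seq (u.1, f u.2) | u <- [seq (x' 0 i, e i) | i <- enum 'I_p]].
  move=> P c cl cr; rewrite -map_comp big_map big_enum /=.
  have -> : \sum_i c (x' 0 i) (f (e i)) =
      \sum_i \sum_j A i j *: c (x' 0 i) (delta_mx 0 j).
    apply: eq_bigr => i _; rewrite fE /= -rowE.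
    rewrite -(linear_combination _ _ (cr _)); congr (c _ _).
    by rewrite [LHS]row_sum_delta; apply: eq_bigr => j _; rewrite mxE.
  rewrite exchange_big big1 //= => j _.
  rewrite -(linear_combination _ _ (cl (delta_mx 0 j))).
  have -> : \sum_i A i j *: x' 0 i = (x' *m A^phi) 0 j.
    by rewrite mxE; apply: eq_bigr => i _; rewrite mxE mulr_algr.
  rewrite x'A mxE; have := cl (delta_mx 0 j) (- 1) 0 0.
  by rewrite scaler0 addr0 scaleN1r addNr.
move=> /(_ tens _ (fun r x => b r x)) H.
have bl y : linear (fun r => b r y).
  have [x <-] := quotient_proj_surj y => a u v; rewrite !bE.
  rewrite /g -quotient_proj_linear; congr quotient_proj.
  apply/ffunP => j; rewrite !ffunE scalerDr.
  by rewrite !scalerA mulrC.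
have := H bl (fun r => linearP (b r)).
rewrite big_map big_enum /=.
have -> : \sum_i b (x' 0 i) (e i) = quotient_proj S [ffun j => x' 0 j].
  have -> : [ffun j => x' 0 j] =
      \sum_i 1 *: [ffun j => (delta_mx 0 i : 'rV[R]_p) 0 j *: x' 0 i].
    apply/ffunP => j; rewrite ffunE sum_ffunE (bigD1 j)//= !ffunE mxE !eqxx.
    rewrite !scale1r big1 ?addr0// => i /negbTE ij.
    by rewrite !ffunE mxE eq_sym ij andbF scale0r scaler0.
  rewrite (linear_combination _ _ (@quotient_proj_linear _ S)).
  by apply: eq_bigr => i _; rewrite bE scale1r.
move=> /quotient_proj_eq0[y yE].
by exists y; apply/rowP => j; rewrite -yE ffunE.
Qed.

Variables (m : ideal R) (m' : ideal R').
Hypothesis mloc : local_ring m.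
Hypothesis inf : inflation m m'.

Lemma in_alg_max a : submodule_set m a -> submodule_set m' (phi a).
Proof. by move=> ma; case: inf => _ _ ->; apply: subset_span; exists a. Qed.

(** The row (1, y') is a relation between [v] and the rows of [- B], hence an R'-combination of
    relations over R. If all of these had first coefficient in m, then 1 would lie in m'. So some
    relation over R has a unit as first coefficient, and it can be solved for [v]. *)
Lemma flat_descent p q (B : 'M[R]_(p, q)) (v : 'rV[R]_q) :
  (exists y', v^phi = y' *m B^phi) -> exists y, v = y *m B.
Proof.
move=> [y' vy']; have [m'loc flat _] := inf.
pose A := col_mx v (- B).
have [noeth _ _] := mloc.
have [|s [K KE]] :=
    noetherian_rows noeth (W := [set x : 'rV[R]_(1 + p) | x *m A = 0]).
  split=> [|a x y xA yA]; first exact: mul0mx.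
  by rewrite /= mulmxDl -scalemxAl xA yA scaler0 addr0.
have exK (x : 'rV_(1 + p)) : x *m A = 0 -> exists y, x = y *m K.
  rewrite -[_ = 0]/([set x | x *m A = 0] _) KE => -[y _ <-]; by exists y.
have [|z zK] := @flat_exact _ _ _ A K flat exK (row_mx 1%:M y').
  by rewrite map_col_mx map_mxN mul_row_col mul1mx mulmxN vy' subrr.
have [i Ki] : exists i, ~ submodule_set m (K i (lshift p 0)).
  apply: contrapT => /forallNP mK.
  apply: (local_proper m'loc).
  have := congr1 (fun x : 'rV_(1 + p) => x 0 (lshift p 0)) zK.
  rewrite row_mxEl mxE eqxx mulr1n => ->.
  rewrite mxE; apply: (submod_sum (submoduleP m')) => j.
  apply: (submodZ (submoduleP m')); rewrite mxE; apply: in_alg_max.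
  by apply: contrapT; exact: mK.
have [u uK] := local_unit mloc Ki.
have : [set x : 'rV[R]_(1 + p) | x *m A = 0] (delta_mx 0 i *m K).
  by rewrite KE; exists (delta_mx 0 i).
rewrite /= -rowE => KA; exists (u *: rsubmx (row i K : 'rV_(1 + p))).
rewrite -scalemxAl; move: KA.
rewrite -{1}[row i K](@hsubmxK _ _ 1 p) mul_row_col mulmxN => /subr0_eq <-.
rewrite [lsubmx _]mx11_scalar mul_scalar_mx scalerA mxE mxE uK.
by rewrite scale1r.
Qed.

End Flat.

(** * Conca generators *)

Section Rowspan.
Variable R : comNzRingType.
Implicit Types I J : set R^o.

(** This is IN for the row space N of [K]. With [K] the matrix [dmx F n] and I = m it is m
    Omega_(n+1). *)
Definition rowspan I s p (K : 'M[R]_(s, p)) : set 'rV[R]_p :=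
  [set w *m K | w in rows I s].

Lemma rowspan_submod I s p (K : 'M[R]_(s, p)) :
  is_submodule I -> is_submodule (rowspan I K).
Proof.
move=> Is; split.
  by exists 0; [exact: (submod0 (rows_submod _ Is))|exact: mul0mx].
move=> a _ _ [x Ix <-] [y Iy <-]; exists (a *: x + y).
  exact: (rows_submod _ Is).2.
by rewrite mulmxDl scalemxAl.
Qed.

Lemma rowspanS I J s p (K : 'M[R]_(s, p)) : I `<=` J -> rowspan I K `<=` rowspan J K.
Proof. by move=> IJ _ [w Iw <-]; exists w => // j; apply: IJ. Qed.

Lemma has_rank_exists (m : ideal R) p (A B : set 'rV[R]_p) : local_ring m ->
  is_submodule A -> is_submodule B -> exists n, has_rank m A B n.
Proof.
move=> mloc As Bs; have [noeth _ _] := mloc.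
have [s [K AK]] := noetherian_rows noeth As.
have [||n _ nP] := @generates_basis R m mloc _ A B s (fun i => row i K) => //.
  split=> [i|x]; first by rewrite AK rowE; exists (delta_mx 0 i).
  rewrite AK => -[y _ <-]; exists (fun i => y 0 i).
  by rewrite /= mulmx_sum_row subrr; exact: submod0.
by exists n.
Qed.

End Rowspan.

Section ConcaStep.
Variables (R : comNzRingType) (m : ideal R) (x : R).
Hypothesis mloc : local_ring m.
Hypothesis xconca : conca_generator m x.

Definition principal : set R^o := [set x * a | a in [set: R]].

Lemma principal_submod : is_submodule principal.
Proof.
split; first by exists 0; rewrite ?mulr0.
move=> a _ _ [b _ <-] [c _ <-]; exists (a * b + c) => //.
by rewrite mulrDr mulrCA.
Qed.

Lemma conca_mul_x a : principal a -> x * a = 0.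
Proof.
have [_ _ x2 _] := xconca.
by move=> [b _ <-]; rewrite mulrA -expr2 x2 mul0r.
Qed.

Lemma principal_max : principal `<=` m.
Proof.
have [mx _ _ _] := xconca.
by move=> _ [a _ <-]; rewrite mulrC; apply: (submodZ (submoduleP m)).
Qed.

Lemma ideal_pow1 : ideal_pow m 1 = m :> set R^o.
Proof.
apply/seteqP; split=> [|a ma].
  apply: ideal_smul_min => [|a b ma _]; first exact: submoduleP.
  by rewrite [_ *: _]mulrC; apply: (submodZ (submoduleP m)).
by rewrite -[a](mulr1 a); apply: (@ideal_smulZ _ _ _ _ a 1).
Qed.

Lemma ideal_pow2_mul a b : submodule_set m a -> submodule_set m b ->
  ideal_pow m 2 (a * b).
Proof.
move=> ma mb; apply: (@ideal_smulZ _ _ _ _ a b) => //.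
by rewrite -/(ideal_pow m 1) ideal_pow1.
Qed.

Lemma conca_pow2P a : ideal_pow m 2 a <-> exists2 c, submodule_set m c & a = x * c.
Proof.
have [_ _ _ <-] := xconca; split=> [[c mc <-]|[c mc ->]]; by exists c.
Qed.

Lemma conca_pow3 a : ideal_pow m 3 a -> a = 0.
Proof.
apply: (ideal_smul_min (@submod_zero R R^o)) => {}a b ma /conca_pow2P[c mc ->].
have /conca_pow2P[d _ ad] := ideal_pow2_mul ma mc.
change ((a : R) * (x * c) = 0); rewrite mulrCA ad mulrA -expr2.
by have [_ _ -> _] := xconca; rewrite mul0r.
Qed.

Lemma rows_pow2P p (z : 'rV[R]_p) : rows (ideal_pow m 2) p z ->
  exists2 u, rows m p u & z = x *: u.
Proof.
move=> Jz.
have /choice[u uP] j : exists c, submodule_set m c /\ z 0 j = x * c.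
  by have /conca_pow2P[c] := Jz j; exists c.
exists (\row_j u j) => [j|]; first by rewrite mxE; case: (uP j).
by apply/rowP => j; rewrite !mxE; case: (uP j).
Qed.

Variables (p q s : nat) (A : 'M[R]_(p, q)) (K : 'M[R]_(s, p)).
Hypothesis exAK : forall y : 'rV_p, y *m A = 0 -> exists z, y = z *m K.
Hypothesis mK : forall i j, submodule_set m (K i j).

(** Let G = R^p, and let N and N' be the row spaces of [A] and [K]. A basis of mN/xN lifts to
    vectors [w i] in mG, and the vectors [x *: w i] generate m^2 G modulo xN'. The submodule mN'
    lies between these two, which splits the dimension into [c'] and [d]. *)
Lemma conca_step c : has_rank m (rowspan m A) (rowspan principal A) c ->
  exists c' d, [/\ has_rank m (rowspan m K) (rowspan principal K) c',
    has_rank m (rows (ideal_pow m 2) p) (rowspan m K) d & (c' + d <= c)%N].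
Proof.
move=> [v [Av gv _]].
have /choice[w wP] : forall i, exists w, rows m p w /\ w *m A = v i.
  by move=> i; have [w mw wv] := Av i; exists w.
have [mx _ _ _] := xconca.
have Ps := rowspan_submod K principal_submod.
have ms := rowspan_submod K (submoduleP m).
have Js := rows_submod p (ideal_pow_submod m 2).
have gen : generates (rows (ideal_pow m 2) p) (rowspan principal K)
    (fun i => x *: w i).
  split=> [i j|z /rows_pow2P[u mu ->]].
    by rewrite mxE; apply: ideal_pow2_mul => //; case: (wP i).
  (* In N the image of [u] is a combination of the [v i] up to an element of xN, that is, up to the
     image of some [f] in xG. Multiplication by x then removes [f], because x^2 = 0. *)
  have [|a [f fP fA]] := gv (u *m A); first by exists u.
  exists a; have [y yK] : exists y, u - \sum_i a i *: w i - f = y *m K.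
    have wA : (\sum_i a i *: w i) *m A = \sum_i a i *: v i.
      rewrite mulmx_suml; apply: eq_bigr => i _.
      by rewrite -scalemxAl (wP i).2.
    by apply: exAK; rewrite !mulmxBl fA wA subrr.
  exists (x *: y) => [j|]; first by rewrite mxE; exists (y 0 j).
  have xf : x *: f = 0 by apply/rowP => j; rewrite !mxE conca_mul_x.
  rewrite -scalemxAl -yK !scalerBr xf subr0 scaler_sumr; congr (_ - _).
  by apply: eq_bigr => i _; rewrite !scalerA mulrC.
have [c1 c1c c1P] := generates_basis mloc Ps gen.
have [|d _ dP] := @generates_basis R m mloc _ (rows (ideal_pow m 2) p)
    (rowspan m K) _ (fun i => x *: w i) ms.
  case: gen => gJ gen; split=> // z /gen[a aP]; exists a.
  by apply: rowspanS aP; exact: principal_max.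
have [c' c'P] := has_rank_exists mloc ms Ps.
exists c', d; split=> //; rewrite addnC.
(* Both sides are the dimension of m^2 G / xN'. It is a dimension over the residue field since m m^2
   G = 0. *)
rewrite (has_rank_uniq (local_proper mloc) Ps
  (has_rank_add _ _ _ _ _ _ dP c'P) c1P)//.
- by apply: rowspanS; exact: principal_max.
- move=> _ [y my <-] j; rewrite mxE.
  apply: (submod_sum (ideal_pow_submod m 2)) => i.
  exact: ideal_pow2_mul.
- move=> a z ma Jz; have -> : a *: z = 0; last exact: submod0.
  apply/rowP => j; rewrite !mxE; apply: conca_pow3.
  exact: (@ideal_smulZ R R^o m (ideal_pow m 2) a (z 0 j) ma (Jz j)).
Qed.

End ConcaStep.

Lemma nonincreasing_stable (c : nat -> nat) : (forall n, c n.+1 <= c n)%N ->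
  exists N, forall n, (N <= n)%N -> c n.+1 = c n.
Proof.
move=> cS; have cle i j : (i <= j)%N -> (c j <= c i)%N.
  elim: j => [|j IH]; first by rewrite leqn0 => /eqP ->.
  by rewrite leq_eqVlt => /predU1P[->//|/IH]; apply: leq_trans.
have ex : exists v, `[< exists n, c n = v >].
  by exists (c 0%N); apply/asboolP; exists 0%N.
have [v /asboolP[N cN] vmin] := ex_minnP ex.
have cE n : (N <= n)%N -> c n = v.
  move=> Nn; apply/eqP; rewrite eqn_leq -{1}cN cle//=.
  by apply: vmin; apply/asboolP; exists n.
by exists N => n Nn; rewrite !cE// leqW.
Qed.

(** * Linearity of a minimal resolution and its descent along the inflation *)

Section Inflation.
Variables (R : comNzRingType) (m : ideal R) (R' : comAlgType R) (m' : ideal R').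
Variable x : R'.
Hypothesis mloc : local_ring m.
Hypothesis inf : inflation m m'.
Hypothesis xconca : conca_generator m' x.
Local Notation phi := (in_alg R').
Local Notation "A ^phi" := (map_mx phi A) (at level 2, format "A ^phi").

Lemma in_alg_pow n a : ideal_pow m n a -> ideal_pow m' n (phi a).
Proof.
elim: n a => [//|n IH] a.
apply: (@ideal_smul_min R R^o m _ (phi @^-1` (ideal_pow m' n.+1))).
  split=> [|b c d cP dP].
    change (ideal_pow m' n.+1 (phi 0)).
    by rewrite rmorph0; exact: (submod0 (ideal_pow_submod _ _)).
  change (ideal_pow m' n.+1 (phi (b * c + d))); rewrite rmorphD rmorphM.
  exact: (ideal_pow_submod _ _).2.
move=> b c mb /IH cP; change (ideal_pow m' n.+1 (phi (b * c))); rewrite rmorphM.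
apply: (@ideal_smulZ R' R'^o _ _ (phi b) (phi c)) => //.
exact: in_alg_max inf _ mb.
Qed.

Lemma inflation_pow3 (a : R) : ideal_pow m 3 a -> a = 0.
Proof.
move=> /in_alg_pow /(conca_pow3 xconca) a0.
(* For a matrix without rows, descent says that R -> R' is injective. *)
have [|y] := @flat_descent _ _ _ _ mloc inf 0 1 0 a%:M.
  exists 0; rewrite mul0mx; apply/matrixP => i j.
  by rewrite !mxE !ord1 eqxx mulr1n; exact: a0.
by rewrite mulmx0 => /matrixP/(_ 0 0); rewrite !mxE eqxx mulr1n.
Qed.

(** Because m' is generated by the image of m, generators [B] of mN over R also generate m' times
    the row space of [K] over R'. Membership in their span descends by [flat_descent]. *)
Lemma rowspan_descent s p (K : 'M[R]_(s, p)) :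
  rows (ideal_pow m' 2) p `<=` rowspan m' K^phi ->
  rows (ideal_pow m 2) p `<=` rowspan m K.
Proof.
move=> JK' v Jv.
have Ws := rowspan_submod K (submoduleP m).
have [noeth _ _] := mloc; have [t [B WB]] := noetherian_rows noeth Ws.
rewrite WB; suff [y ->] : exists y, v = y *m B by exists y.
apply: (flat_descent mloc inf).
have [|w mw <-] := JK' v^phi; first by move=> j; rewrite mxE; exact: in_alg_pow.
suff : range (fun y : 'rV_t => y *m B^phi) (w *m K^phi) by case=> y _ <-; exists y.
have Bs := is_submodule_range_mul B^phi.
rewrite mulmx_sum_row; apply: submod_sum => // i.
have : m' `<=` [set r | range (fun y : 'rV_t => y *m B^phi) (r *: row i K^phi)].
  have [_ _ ->] := inf.
  apply: span_min => [|_ [a ma <-]].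
    split=> [|r b c bP cP]; first by rewrite /= scale0r; exact: (submod0 Bs).
    rewrite /= scalerDl -scalerA; exact: Bs.2.
  have : rowspan m K (a *: row i K).
    exists (a *: delta_mx 0 i) => [j|]; last by rewrite -scalemxAl -rowE.
    by rewrite mxE mulrC; exact: (submodZ (submoduleP m) _ ma).
  rewrite WB => -[y _ yB]; exists y^phi => //.
  by rewrite -map_mxM yB map_mxZ map_row.
exact.
Qed.

Variables (M : lmodType R) (F : free_resolution M).
Hypothesis Fmin : minimal_resolution m F.

(** This amounts to m^2 F_n = m Omega_(n+1), as minimality of F gives the other inclusion. *)
Definition linear_at n := rows (ideal_pow m 2) (frank F n) `<=` rowspan m (dmx F n).

Lemma minimal_dmx n i j : submodule_set m (dmx F n i j).
Proof.
have : ideal_smul m [set: chain F n] `<=` rows m _.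
  by rewrite (ideal_smul_rows _ (submoduleP m)).
move=> /(_ (delta_mx 0 i *m dmx F n)); rewrite -rowE.
move=> /(_ _ j); rewrite mxE; apply; rewrite rowE; apply: Fmin.
by exists (delta_mx 0 i).
Qed.

Lemma inflation_step n c :
  has_rank m' (rowspan m' (dmx F n)^phi) (rowspan (principal x) (dmx F n)^phi) c ->
  exists c' d, [/\
    has_rank m' (rowspan m' (dmx F n.+1)^phi)
      (rowspan (principal x) (dmx F n.+1)^phi) c',
    (d = 0 -> linear_at n.+1)%N & (c' + d <= c)%N].
Proof.
have [m'loc flat _] := inf; move=> cP.
have [||c' [d [c'P dP cd]]] :=
    conca_step m'loc xconca (K := (dmx F n.+1)^phi) _ _ cP.
- apply: flat_exact => // y /dmx_ker[z <-]; by exists z.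
- by move=> i j; rewrite mxE; apply: (in_alg_max inf); exact: minimal_dmx.
- exists c', d; split=> // d0; apply: rowspan_descent.
  by move: dP; rewrite d0; exact: has_rank0.
Qed.

Lemma linear_eventually : exists N, forall n, (N <= n)%N -> linear_at n.
Proof.
have [m'loc flat _] := inf.
have /choice[c cP] n : exists c,
    has_rank m' (rowspan m' (dmx F n)^phi) (rowspan (principal x) (dmx F n)^phi) c.
  apply: has_rank_exists => //; apply: rowspan_submod.
    exact: submoduleP.
  exact: principal_submod.
have cS n : exists d, (d = 0 -> linear_at n.+1)%N /\ (c n.+1 + d <= c n)%N.
  have [c' [d [c'P dP cd]]] := inflation_step (cP n).
  exists d; split=> //.
  rewrite (has_rank_uniq (local_proper m'loc) _ (cP n.+1) c'P)//.
  exact: rowspan_submod (principal_submod x).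
have [n|N cN] := @nonincreasing_stable c.
  by have [d [_ cd]] := cS n; apply: leq_trans cd; exact: leq_addr.
(* The drop from [c n] to [c n.+1] controls linearity at [n.+1], whence the shift by one. *)
exists N.+1 => -[//|n] Nn; have [d [dP cd]] := cS n; apply: dP.
by apply/eqP; rewrite -leqn0 -(leq_add2l (c n.+1)) addn0 {2}cN.
Qed.

End Inflation.

Section ResidueField.
Variables (R : comNzRingType) (m : ideal R) (R' : comAlgType R) (m' : ideal R').
Variable x : R'.
Hypothesis mloc : local_ring m.
Hypothesis inf : inflation m m'.
Hypothesis xconca : conca_generator m' x.
Variable F : free_resolution (residue_field m).
Hypothesis Fmin : minimal_resolution m F.
Local Notation phi := (in_alg R').
Local Notation "A ^phi" := (map_mx phi A) (at level 2, format "A ^phi").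

Lemma residue_field_torsion (a : R) (y : residue_field m) :
  submodule_set m a -> a *: y = 0.
Proof.
move=> ma; have [b <-] := quotient_proj_surj y.
rewrite -[_ *: _]/(quotient_scale a (quotient_proj m b)) -quotient_projZ.
apply/quotient_proj_eq0; rewrite [_ *: _]mulrC.
exact: (submodZ (submoduleP m)).
Qed.

Lemma residue_syzygy (z : 'rV[R]_(frank F 0)) : rows m _ z ->
  exists y, y *m dmx F 0 = z.
Proof.
move=> mz; apply: augm_ker; rewrite [z]row_sum_delta linear_sum big1// => i _.
by rewrite linearZ; exact: residue_field_torsion.
Qed.

Lemma linear_residue n : linear_at m F n.
Proof.
have [m'loc flat m'E] := inf.
(* If all these dimensions vanish, so does every defect [d]. No step ends at index 0; there m F_0 is
   contained in Omega_1, so m^2 F_0 is contained in m Omega_1. *)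
suff cP : forall n, has_rank m' (rowspan m' (dmx F n)^phi)
    (rowspan (principal x) (dmx F n)^phi) 0.
  case: n => [|n].
    have Ks := rowspan_submod (dmx F 0) (submoduleP m).
    move=> v Jv; rewrite [v]row_sum_delta; apply: submod_sum => // i.
    have : ideal_pow m 2 `<=` [set r | rowspan m (dmx F 0) (r *: delta_mx 0 i)].
      apply: (@ideal_smul_min R R^o).
        split=> [|r b c Wb Wc]; first by rewrite /= scale0r; exact: (submod0 Ks).
        by rewrite /= scalerDl -scalerA; exact: Ks.2.
      move=> a b ma; rewrite -/(ideal_pow m 1) ideal_pow1 => mb /=.
      have [|y yE] := residue_syzygy (z := b *: delta_mx 0 i).
        by move=> j; rewrite mxE mulrC; exact: (submodZ (submoduleP m) _ mb).
      exists (a *: y) => [j|]; last by rewrite -scalemxAl yE scalerA.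
      by rewrite mxE mulrC; exact: (submodZ (submoduleP m) _ ma).
    exact.
  have [c' [d [_ dP]]] := inflation_step mloc inf xconca Fmin (cP n).
  by rewrite leqn0 addn_eq0 => /andP[_ /eqP /dP].
move=> {}n; elim: n => [|n IH]; last first.
  have [c' [d [c'P _]]] := inflation_step mloc inf xconca Fmin IH.
  by rewrite leqn0 addn_eq0 => /andP[/eqP c0 _]; move: c'P; rewrite c0.
(* Over R', let N be the row space of [dmx F 0]. It contains m'G for G the base change of F_0,
   because m kills k, and minimality gives the reverse inclusion. So m'N lies in m'^2 G = x(m'G),
   which is contained in xN. *)
apply: has_rank0P => _ [w mw <-].
have [|u mu ->] := rows_pow2P xconca (z := w *m (dmx F 0)^phi).
  move=> j; rewrite mxE; apply: (submod_sum (ideal_pow_submod m' 2)) => i.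
  apply: ideal_pow2_mul => //.
  by rewrite mxE; apply: (in_alg_max inf); exact: minimal_dmx.
have Ks := is_submodule_range_mul (dmx F 0)^phi.
have [y _ <-] : range (fun y : 'rV_(frank F 1) => y *m (dmx F 0)^phi) u.
  rewrite [u]row_sum_delta; apply: submod_sum => // i.
  have : m' `<=` [set r | range (fun y : 'rV_(frank F 1) => y *m (dmx F 0)^phi)
      (r *: delta_mx 0 i)].
    rewrite m'E; apply: span_min => [|_ [a ma <-]].
      split=> [|r b c Wb Wc]; first by rewrite /= scale0r; exact: (submod0 Ks).
      by rewrite /= scalerDl -scalerA; exact: Ks.2.
    have [|y yE] := residue_syzygy (z := a *: delta_mx 0 i).
      by move=> j; rewrite mxE mulrC; exact: (submodZ (submoduleP m) _ ma).
    by exists y^phi => //; rewrite -map_mxM yE map_mxZ map_delta_mx.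
  exact.
exists (x *: y) => [j|]; last by rewrite -scalemxAl.
by rewrite mxE; exists (y 0 j).
Qed.

End ResidueField.

(** * Koszul modules *)

Section Koszul.
Variables (R : comNzRingType) (m : ideal R).
Hypothesis m3 : forall a : R, ideal_pow m 3 a -> a = 0.
Variables (M : lmodType R) (F : free_resolution M).
Hypothesis Fmin : minimal_resolution m F.

Lemma ideal_pow_ge3 i (a : R) : ideal_pow m i.+3 a -> a = 0.
Proof.
elim: i a => [|i IH] a; first exact: m3.
apply: (ideal_smul_min (@submod_zero R R^o)) => {}a b _ /IH ->.
exact: mulr0.
Qed.

Lemma rows_ge3 i p (z : 'rV[R]_p) : rows (ideal_pow m i.+3) p z -> z = 0.
Proof. by move=> z0; apply/rowP => j; rewrite mxE (ideal_pow_ge3 (z0 j)). Qed.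

Lemma rows_zero I p : is_submodule I -> rows I p (0 : 'rV[R]_p).
Proof. by move=> Is; exact: (submod0 (rows_submod _ Is)). Qed.

Lemma range_dmx_max n (y : 'rV_(frank F n.+1)) : rows m _ (y *m dmx F n).
Proof.
move=> j; rewrite mxE; apply: (submod_sum (submoduleP m)) => i.
by apply: (submodZ (submoduleP m)); exact: minimal_dmx.
Qed.

Lemma rowspan_dmx_pow2 n (y : 'rV_(frank F n.+1)) : rows m _ y ->
  rows (ideal_pow m 2) _ (y *m dmx F n).
Proof.
move=> my j; rewrite mxE; apply: (submod_sum (ideal_pow_submod m 2)) => i.
by apply: ideal_pow2_mul => //; exact: minimal_dmx.
Qed.

(** By linearity the image of [x] is also the image of some [w] in m F_(n+1); the difference is a
    cycle, and cycles lie in m F_(n+1) by minimality. *)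
Lemma linear_at_max n (x : 'rV_(frank F n.+1)) : linear_at m F n ->
  rows (ideal_pow m 2) _ (x *m dmx F n) -> rows m _ x.
Proof.
move=> lin /lin[w mw wx]; have [|y yx] := @dmx_ker _ _ F n (x - w).
  by rewrite mulmxBl wx subrr.
apply: (submod_subl (rows_submod _ (submoduleP m))) mw.
by rewrite -yx; exact: range_dmx_max.
Qed.

Lemma filt_augm j y : filt m j y ->
  exists2 z, rows (ideal_pow m j) (frank F 0) z & augm F z = y.
Proof.
have Js := rows_submod (frank F 0) (ideal_pow_submod m j).
apply: (ideal_smul_min (W := [set y | exists2 z, rows (ideal_pow m j) (frank F 0) z &
    augm F z = y])).
  split=> [|a _ _ [x Jx <-] [z Jz <-]].
    by exists 0; [exact: submod0|exact: linear0].
  by exists (a *: x + z); [exact: Js.2|exact: linearP].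
move=> a u ja _; have [x <-] := augm_lift F u.
exists (a *: x) => [i|]; last exact: linearZ.
by rewrite mxE mulrC; exact: (submodZ (ideal_pow_submod m j) _ ja).
Qed.

Lemma lin_numE j n : lin_num m F j n =
  if (n <= j)%N then rows (ideal_pow m (j - n)) _ else [set 0].
Proof. by rewrite /lin_num (ideal_smul_rows _ (ideal_pow_submod m _)). Qed.

Lemma lin_denE j n : lin_den m F j n =
  if (n <= j)%N then rows (ideal_pow m (j.+1 - n)) _ else [set 0].
Proof. by rewrite /lin_den (ideal_smul_rows _ (ideal_pow_submod m _)). Qed.

Hypothesis Flin : forall n, linear_at m F n.

(** As m^3 = 0, each F_n has only the layers F/mF, mF/m^2 F and m^2 F. At F_(n+1), the first layer
    is exact by [linear_at_max]. In the second, a cycle of the linear strand has differential in m^3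
    F_n = 0, so it is a cycle of F and hence a boundary. The third lies in m Omega_(n+2) by
    linearity. At F_0 a cycle of the strand differs from a cycle of F by some [w] in m^(j+1) F_0. *)
Lemma linear_acyclic j : lin_acyclic m F j.
Proof.
split.
- move=> y /filt_augm[z Jz <-]; exists z; first by rewrite lin_numE subn0.
  by rewrite subrr; exact: (submod0 (submoduleP _)).
- move=> x; rewrite !lin_numE lin_denE !leq0n !subn0 => Jx /filt_augm[w Jw wx].
  have [y yx] : exists y, y *m dmx F 0 = x - w.
    by apply: augm_ker; rewrite linearB /= wx subrr.
  have zero0 (z : 'rV_(frank F 0)) : z = 0 -> rows (ideal_pow m j.+1) _ z.
    by move=> ->; exact: rows_zero (ideal_pow_submod m j.+1).
  case: j Jx Jw zero0 => [|[|[|j]]] Jx Jw zero0.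
  + exists 0 => //; rewrite [bd F 0 0]mul0mx subr0 ideal_pow1.
    apply: (submod_subl (rows_submod _ (submoduleP m)) (y := w)).
      by rewrite -yx; exact: range_dmx_max.
    by rewrite -(ideal_pow1 m).
  + by exists y => //; rewrite [bd F 0 y]yx subKr.
  + have w0 := rows_ge3 Jw.
    have [z mz zx] := Flin Jx.
    exists z; first by rewrite subn1 ideal_pow1.
    by apply: zero0; rewrite [bd F 0 z]zx subrr.
  + exists 0; first exact: rows_zero (ideal_pow_submod m _).
    by apply: zero0; rewrite [bd F 0 0]mul0mx subr0; exact: rows_ge3 Jx.
- move=> n x; rewrite !lin_numE !lin_denE.
  have [nj|nj] := leqP n.+1 j; last first.
    move=> -> _; exists 0; last by rewrite [bd F _ 0]mul0mx subr0.
    by rewrite leqNgt (leq_trans nj (leqnSn _)).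
  rewrite -(subnKC nj); move: (j - n.+1)%N => i {j nj}.
  have -> : (n <= n.+1 + i)%N by rewrite addSnnS leq_addr.
  have -> : (n.+1 + i - n.+1 = i)%N by rewrite addKn.
  have -> : ((n.+1 + i).+1 - n = i.+2)%N by rewrite addSn -!addnS addKn.
  have -> : (n.+1 + i - n.+2 = i.-1)%N by rewrite addSn subSS -addn1 subnDl subn1.
  have -> : ((n.+1 + i).+1 - n.+1 = i.+1)%N by rewrite -addnS addKn.
  (* From here on [i] is the power of m at F_(n+1). At i = 0 the truncated [i.-1] does no harm: the
     strand has no term at F_(n+2), and the boundary has to be 0. *)
  rewrite -[X in (X < _)%N]addn0 ltn_add2l => Jx bdx.
  case: i Jx bdx => [|[|[|i]]] Jx bdx.
  + exists 0 => //; rewrite [bd F _ 0]mul0mx subr0 ideal_pow1.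
    exact: (linear_at_max (Flin (n := n)) bdx).
  + have [z zx] := dmx_ker (rows_ge3 bdx).
    exists z => //; rewrite [bd F _ z]zx subrr.
    exact: rows_zero (ideal_pow_submod m _).
  + have [z mz zx] := Flin Jx.
    exists z; first by rewrite ideal_pow1.
    by rewrite [bd F _ z]zx subrr; exact: rows_zero (ideal_pow_submod m _).
  + exists 0; first exact: rows_zero (ideal_pow_submod m _).
    rewrite [bd F _ 0]mul0mx subr0 (rows_ge3 Jx).
    exact: rows_zero (ideal_pow_submod m _).
Qed.

End Koszul.

(** * Syzygy modules resolved by truncation *)

Section Shift.
Variables (R : comNzRingType) (m : ideal R) (M : lmodType R).
Variables (F : free_resolution M) (n : nat).

Let syzygy_augm : chain F n -> syzygy F n := quotient_proj _.

HB.instance Definition _ := GRing.isLinear.Build R (chain F n) (syzygy F n) _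
  syzygy_augm (@quotient_proj_linear _ _ _).

Lemma syzygy_augm_surj : range syzygy_augm = [set: syzygy F n].
Proof.
apply/seteqP; split=> // y _; have [x <-] := quotient_proj_surj y.
by exists x.
Qed.

Lemma syzygy_augm_exact : [set x | syzygy_augm x = 0] =
  range (fun y : 'rV_(frank F n.+1) => y *m dmx F n).
Proof.
apply/seteqP; split=> x xP; last exact/quotient_proj_eq0.
by move/quotient_proj_eq0 : xP.
Qed.

(** With the index [i + n], and not [n + i], the successor [i.+1 + n] is convertible to
    [(i + n).+1], as the types of the differentials require. *)
Definition shift_resolution : free_resolution (syzygy F n) :=
  @FreeResolution R (syzygy F n) (fun i => frank F (i + n))
    (fun i => dmx F (i + n)) syzygy_augm syzygy_augm_surj syzygy_augm_exact
    (fun i => diff_exact F (i + n)).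

End Shift.

Lemma koszul_syzygy (R : comNzRingType) (m : ideal R) (M : lmodType R)
  (F : free_resolution M) n :
  (forall a : R, ideal_pow m 3 a -> a = 0) -> minimal_resolution m F ->
  (forall i, (n <= i)%N -> linear_at m F i) -> koszul_module m (syzygy F n).
Proof.
move=> m3 Fmin Flin; exists (shift_resolution F n).
  by move=> i; exact: Fmin (i + n)%N.
apply: (linear_acyclic m3) => i; first exact: Fmin (i + n)%N.
by apply: (Flin (i + n)%N); exact: leq_addl.
Qed.

(** * Betti numbers *)

Section Betti.
Variables (R : comNzRingType) (m : ideal R).
Hypothesis mloc : local_ring m.
Let m1 : ~ submodule_set m 1 := local_proper mloc.

Lemma ideal_has_rank (I J : set R^o) : is_submodule I -> is_submodule J ->
  exists n, has_rank m I J n.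
Proof.
move=> Is Js; have [noeth _ _] := mloc; have [s sI] := noeth (Submodule Is).
have [||n _ nP] := @generates_basis R m mloc _ I J (size s) (fun i => s`_i) => //.
  split=> [i|x]; first by rewrite [I]sI; apply: subset_span; exact: mem_nth.
  rewrite [I]sI => /span_seqP[a ->]; exists a; rewrite subrr; exact: submod0.
by exists n.
Qed.

Lemma has_rank_residue : has_rank m [set: R^o] m 1.
Proof.
exists (fun=> 1); split=> // [x _|a].
  exists (fun=> x); rewrite big_ord1 [_ *: _]mulr1 subrr.
  exact: (submod0 (submoduleP m)).
by rewrite big_ord1 [_ *: _]mulr1 => ma i; rewrite ord1.
Qed.

Lemma has_rank_chain p : has_rank m [set: 'rV[R]_p] (rows m p) p.
Proof.
have := has_rank_rows p (submod_setT _) (submoduleP m) has_rank_residue.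
by rewrite muln1; congr has_rank; apply/seteqP; split.
Qed.

Lemma has_rank_residue_field : has_rank m [set: residue_field m] [set 0] 1.
Proof.
pose pL : {linear R^o -> residue_field m} := HB.pack (quotient_proj m)
  (GRing.isLinear.Build R R^o _ _ (quotient_proj m) (@quotient_proj_linear R R^o m)).
apply: (has_rank_image (f := pL) _ _ _ _ _ _ has_rank_residue) => //.
- by move=> x mx; apply/quotient_proj_eq0.
- by move=> x _ /quotient_proj_eq0.
- exact: submod_zero.
- move=> y _; have [x <-] := quotient_proj_surj y; exists x => //.
  exact: subrr.
Qed.

Lemma residue_scale (a b : R) :
  a *: (quotient_proj m b : residue_field m) = quotient_proj m (a * b).
Proof. by rewrite -[a * b]/(a *: (b : R^o)) quotient_projZ. Qed.

Hypothesis m3 : forall a : R, ideal_pow m 3 a -> a = 0.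
Variables (M : lmodType R) (F : free_resolution M).
Hypothesis Fmin : minimal_resolution m F.
Let e := rank m m (ideal_pow m 2).
Let r := rank m (ideal_pow m 2) (ideal_pow m 3).

Let has_e : has_rank m m (ideal_pow m 2) e.
Proof.
have [n nP] := ideal_has_rank (submoduleP m) (ideal_pow_submod m 2).
by rewrite /e (rankE m1 _ nP)//; exact: ideal_pow_submod.
Qed.

Let has_r : has_rank m (ideal_pow m 2) (ideal_pow m 3) r.
Proof.
have [n nP] := ideal_has_rank (ideal_pow_submod m 2) (ideal_pow_submod m 3).
by rewrite /r (rankE m1 _ nP)//; exact: ideal_pow_submod.
Qed.

(** The differential maps F_(n+1)/m F_(n+1) isomorphically onto Omega_(n+1)/m Omega_(n+1), and
    linearity replaces m Omega_(n+1) by m^2 F_n. *)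
Lemma has_rank_syzygy n : linear_at m F n ->
  has_rank m (range (fun y : 'rV_(frank F n.+1) => y *m dmx F n))
    (rows (ideal_pow m 2) _) (frank F n.+1).
Proof.
move=> lin.
apply: (has_rank_image (f := mulmxr (dmx F n)) _ _ _ _ _ _ (has_rank_chain _)) => //.
- move=> x mx; exact: rowspan_dmx_pow2.
- move=> x _; exact: linear_at_max.
- exact: rows_submod (ideal_pow_submod m 2).
- move=> _ [y _ <-]; exists y => //=; rewrite subrr.
  exact: rows_zero (ideal_pow_submod m 2).
Qed.

(** The differential maps m F_(n+1) onto m Omega_(n+1) = m^2 F_n with kernel Omega_(n+2). Since m^3
    = 0, the dimension of m^2 F_n is [frank F n * r]. *)
Lemma has_rank_max_syzygy n : linear_at m F n ->
  has_rank m (rows m _) (range (fun y : 'rV_(frank F n.+2) => y *m dmx F n.+1))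
    (frank F n * r)%N.
Proof.
move=> lin; have Ms := rows_submod (frank F n.+1) (submoduleP m).
have J3E p : rows (ideal_pow m 3) p = [set 0].
  apply/seteqP; split=> [z|_ ->]; first exact: rows_ge3.
  exact: rows_zero (ideal_pow_submod m 3).
have Js := ideal_pow_submod m.
have [s sP] := has_rank_exists mloc Ms (is_submodule_range_mul (dmx F n.+1)).
have := has_rank_rows (frank F n) (Js 2) (Js 3) has_r; rewrite J3E => rP.
rewrite (has_rank_uniq m1 (@submod_zero _ _) rP (p := s))//.
apply: (has_rank_image (f := mulmxr (dmx F n)) _ _ _ _ _ _ sP) => //.
- move=> x; exact: rowspan_dmx_pow2.
- by move=> _ [y _ <-]; rewrite /= -mulmxA dmx_dmx mulmx0.
- by move=> x _ /dmx_ker[y <-]; exists y.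
- exact: submod_zero.
- move=> z /lin[w mw <-]; exists w => //; exact: subrr.
Qed.

Lemma betti_recurrence n : linear_at m F n -> linear_at m F n.+1 ->
  (frank F n.+1 * e = frank F n * r + frank F n.+2)%N.
Proof.
move=> lin linS; have Js := ideal_pow_submod m.
have Ms := rows_submod (frank F n.+1) (submoduleP m).
have eP := has_rank_rows (frank F n.+1) (submoduleP m) (Js 2) has_e.
apply: (has_rank_uniq m1 (rows_submod _ (Js 2)) eP).
(* Omega_(n+2) cuts m F_(n+1)/m^2 F_(n+1) in two: the upper part is counted by linearity at n, the
   lower one by linearity at n + 1. *)
apply: (has_rank_add _ _ _ _ _ _
  (has_rank_max_syzygy lin) (has_rank_syzygy linS)) => //.
- exact: is_submodule_range_mul.
- exact: rows_submod (Js 2).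
- by move=> z /linS[w _ <-]; exists w.
- by move=> _ [y _ <-]; exact: range_dmx_max.
- by move=> a x ma mx j; rewrite mxE; exact: ideal_pow2_mul.
Qed.

(** Linear maps to k kill mF, so all differentials of Hom(F, k) vanish and Ext^n is Hom(F_n, k),
    with the coordinates modulo m as a basis. *)
Lemma minimal_ext_rank n : has_rank m (ext_cocycles F (residue_field m) n)
  (ext_coboundaries F (residue_field m) n) (frank F n).
Proof.
have fm k (f : chain F k -> residue_field m) x : linear f -> rows m _ x -> f x = 0.
  move=> fl mx; rewrite [x]row_sum_delta (linear_combination _ _ fl).
  by rewrite big1// => i _; exact: residue_field_torsion.
pose v i : chain F n -> residue_field m := fun x => quotient_proj m (x 0 i).
have vsum (a : 'I_(frank F n) -> R) x :
    (\sum_i a i *: v i) x = \sum_i a i *: v i x.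
  by rewrite fct_sumE; apply: eq_bigr.
have vl i : linear (v i).
  move=> a x y; rewrite /v !mxE; exact: (@quotient_proj_linear R R^o).
have cob0 f : ext_coboundaries F (residue_field m) n f -> f = 0.
  case: (n) f {v vsum vl} => [//|k] f [g gl ->].
  by apply/funext => x; apply: (fm _ g) => //; exact: range_dmx_max.
exists v; split.
- move=> i; split; first exact: vl.
  by move=> x; apply: fm => //; exact: range_dmx_max.
- move=> f [fl _].
  have /choice[a aE] i : exists b : R, quotient_proj m b = f (delta_mx 0 i).
    exact: (@quotient_proj_surj R R^o m).
  exists a; have -> : f - \sum_i a i *: v i = 0.
    apply/funext => x; apply/eqP.
    rewrite [_ x]/(f x - (\sum_i a i *: v i) x) subr_eq0.
    rewrite vsum [x in f x]row_sum_delta (linear_combination _ _ fl); apply/eqP.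
    apply: eq_bigr => i _; by rewrite -aE /v !residue_scale mulrC.
  exact: submod0 (ext_coboundaries_submod _ _ _).
- move=> a /cob0 a0 i; apply/(@quotient_proj_eq0 R R^o).
  have := congr1 (fun f => f (delta_mx 0 i)) a0.
  rewrite vsum (bigD1 i)//= /v mxE !eqxx residue_scale mulr1.
  rewrite big1 ?addr0// => j /negbTE ji.
  rewrite mxE eqxx ji residue_scale mulr0.
  by apply/quotient_proj_eq0; exact: (submod0 (submoduleP m)).
Qed.

Lemma poincare_series_minimal n : poincare_series m M n = (frank F n)%:Z.
Proof.
congr Posz; apply: xget_unique; first by exists F; exact: minimal_ext_rank.
move=> b [G /(ext_has_rank_resolution F) bP].
exact: (has_rank_uniq m1 (ext_coboundaries_submod _ F n) bP (minimal_ext_rank n)).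
Qed.

End Betti.

Section ResidueBetti.
Variables (R : comNzRingType) (m : ideal R).
Hypothesis mloc : local_ring m.
Hypothesis m3 : forall a : R, ideal_pow m 3 a -> a = 0.
Variable F : free_resolution (residue_field m).
Hypothesis Fmin : minimal_resolution m F.
Hypothesis lin : linear_at m F 0.

Lemma residue_betti0 : frank F 0 = 1%N.
Proof.
have m1 := local_proper mloc.
apply: (has_rank_uniq m1 (@submod_zero _ _) _ (has_rank_residue_field m)).
apply: (has_rank_image (f := augm F) _ _ _ _ _ _ (has_rank_chain _ _)) => //.
- move=> x /residue_syzygy[y <-]; exact: augm_dmx.
- by move=> x _ /augm_ker[y <-]; exact: range_dmx_max.
- exact: submod_zero.
- by move=> y _; have [x <-] := augm_lift F y; exists x => //; exact: subrr.
Qed.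

Lemma residue_betti1 : frank F 1 = rank m m (ideal_pow m 2).
Proof.
have m1 := local_proper mloc.
have [e eP] := ideal_has_rank mloc (submoduleP m) (ideal_pow_submod m 2).
rewrite (rankE m1 (ideal_pow_submod m 2) eP).
rewrite -[RHS]mul1n -[X in (X * _)%N]residue_betti0.
have Js := ideal_pow_submod m 2.
have := has_rank_syzygy Fmin lin.
have -> : range (fun y : 'rV_(frank F 1) => y *m dmx F 0) = rows m _.
  apply/seteqP; split=> [_ [y _ <-]|z /residue_syzygy[y <-]]; last by exists y.
  exact: range_dmx_max.
move=> f1; apply: (has_rank_uniq m1 (rows_submod _ Js) f1).
exact: (has_rank_rows _ (submoduleP m) Js eP).
Qed.

End ResidueBetti.

(** * The recurrence as a product of power series *)

Section PowerSeries.
Variables (e r : nat).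
Let D : {poly int} := 1 - e%:Z *: 'X + r%:Z *: 'X^2.

Lemma coef_denominator n : D`_n = nth 0 [:: 1; - e%:Z; r%:Z] n.
Proof.
rewrite /D coefD coefB coef1 !coefZ coefX coefXn.
by case: n => [|[|[|n]]]; rewrite /= ?nth_nil; ring.
Qed.

Lemma denominator_mul P n : pseries_mul P (fun n => D`_n) n.+2 =
  P n.+2 - e%:Z * P n.+1 + r%:Z * P n.
Proof.
rewrite /pseries_mul !big_ord_recr /= big1 => [|i _].
  by rewrite subnn subSnn -addn2 addKn !coef_denominator /=; ring.
rewrite coef_denominator (subSn (ltnW (leqW (ltn_ord i)))).
by rewrite (subSn (ltnW (ltn_ord i))) -subnSK //= nth_nil mulr0.
Qed.

End PowerSeries.

Lemma finite_residue_field (R : comNzRingType) (m : ideal R) :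
  finite_module (residue_field m).
Proof.
exists [:: (quotient_proj m 1 : residue_field m)]; apply/seteqP; split=> // y _.
have [a <-] := quotient_proj_surj y; apply/span_seqP; exists (fun=> a).
by rewrite big_ord1 /= (residue_scale m a 1) mulr1.
Qed.

Lemma recurrence_denominator (e r : nat) (b : nat -> nat) n :
  (b n.+1 * e = b n * r + b n.+2)%N ->
  pseries_mul (fun i => (b i)%:Z)
    (fun i => (1 - e%:Z *: 'X + r%:Z *: 'X^2 : {poly int})`_i) n.+2 = 0.
Proof.
move=> /(congr1 Posz); rewrite denominator_mul PoszD !PoszM => be.
by rewrite [e%:Z * _]mulrC be; ring.
Qed.

Theorem theorem1p1 (R : comNzRingType) (m : ideal R) (hR : local_ring m)
    (hconca : exists (R' : comAlgType R) (m' : ideal R'),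
        inflation m m' /\ exists x : R', conca_generator m' x) :
  let e := rank m m (ideal_pow m 2) in
  let r := rank m (ideal_pow m 2) (ideal_pow m 3) in
  let D : {poly int} := 1 - e%:Z *: 'X + r%:Z *: 'X^2 in
  [/\ koszul_ring m,
      forall M : lmodType R, finite_module M ->
        exists F : free_resolution M, minimal_resolution m F /\
          exists n : nat, koszul_module m (syzygy F n),
      pseries_eq_frac (poincare_series m (residue_field m)) 1 D
    & forall M : lmodType R, finite_module M ->
        exists p : {poly int}, pseries_eq_frac (poincare_series m M) p D].
Proof.
have [R' [m' [inf [x xconca]]]] := hconca => e r D.
have m3 := inflation_pow3 hR inf xconca.
have D0 : D`_0 \is a GRing.unit by rewrite coef_denominator.
have [K Kmin] := minimal_resolution_exists hR (finite_residue_field m).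
have Klin n := linear_residue hR inf xconca Kmin n.
split.
- by exists K => //; exact: (linear_acyclic m3 Kmin Klin).
- move=> M /(minimal_resolution_exists hR)[F Fmin]; exists F; split=> //.
  have [N Flin] := linear_eventually hR inf xconca Fmin.
  by exists N; exact: koszul_syzygy.
- split=> //; rewrite (funext (poincare_series_minimal hR Kmin)).
  apply/funext => -[|[|n]].
  + rewrite /pseries_mul big_ord1 coef_denominator coef1 /=.
    by rewrite (residue_betti0 hR Kmin).
  + rewrite /pseries_mul !big_ord_recr big_ord0 !coef_denominator coef1 /=.
    rewrite (residue_betti0 hR Kmin) (residue_betti1 hR Kmin (Klin 0%N)).
    by rewrite -/e; ring.
  + rewrite coef1; apply: (recurrence_denominator (b := frank K)).
    exact: (betti_recurrence hR m3 Kmin (Klin _) (Klin _)).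
- move=> M /(minimal_resolution_exists hR)[F Fmin].
  have [N Flin] := linear_eventually hR inf xconca Fmin.
  pose f := pseries_mul (poincare_series m M) (fun i => D`_i).
  (* The recurrence between b_n, b_(n+1) and b_(n+2) holds for n >= N and kills the coefficient of
     index n + 2, so the product with [D] ends before degree N + 2. *)
  exists (\poly_(i < N.+2) f i); split=> //; apply/funext => n.
  rewrite coef_poly -/(f n); case: ltnP => //.
  case: n => [|[|n]]// Nn.
  rewrite /f (funext (poincare_series_minimal hR Fmin)).
  apply: (recurrence_denominator (b := frank F)).
  apply: (betti_recurrence hR m3 Fmin); apply: Flin => //; exact: leqW.
Qed.
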